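(* Let $X$ and $Y$ be uniformly discrete metric spaces of bounded geometry, and suppose $X$ is coarsely equivalent to $Y$. Then $C^*_u(X)$ is nuclear if and only if $C^*_u(Y)$ is nuclear, and $C^*_u(X)$ is exact if and only if $C^*_u(Y)$ is exact.
   Context: A metric space $(X,d)$ is uniformly discrete if there is $c>0$ with $d(x,y)\ge c$ for all distinct $x,y\in X$. A uniformly discrete metric space has bounded geometry if for every $R>0$ there is $N$ such that every ball $B_R(x)$ has at most $N$ points. A bounded operator $T$ on $l^2(X)$, viewed as a matrix $(T(x,y))_{x,y\in X}$, has finite propagation if there is $R\ge 0$ with $T(x,y)=0$ whenever $d(x,y)>R$. The uniform Roe algebra $C^*_u(X)$ is the norm closure in $B(l^2(X))$ of the algebra of bounded operators on $l^2(X)$ having finite propagation. *)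

(* Defs.v *)
From HB Require Import structures.
From mathcomp Require Import all_boot all_order all_algebra.
From mathcomp Require Import all_classical all_reals all_analysis.
From mathcomp Require Import complex lra ring.

Set Implicit Arguments.
Unset Strict Implicit.
Unset Printing Implicit Defensive.

Import Order.TTheory GRing.Theory Num.Theory.
Import numFieldNormedType.Exports Normc.

Local Open Scope classical_set_scope.
Local Open Scope ring_scope.
Local Open Scope complex_scope.

(* Complex Hilbert spaces, over the complex numbers R[i] of a realType R; the
   inner product is linear in its first argument. *)
HB.mixin Record isHilbert (R : realType) (V : Type)
    & CompleteNormedModule R[i] V := {
  hdot : {dot V for (@Num.conj R[i])};
  hdot_norm : forall u : V, hdot u u = `|u| ^+ 2
}.

#[short(type="hilbertType")]
HB.structure Definition Hilbert (R : realType) :=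
  { V of CompleteNormedModule R[i] V & isHilbert R V }.

Section dot_norm.
Context (C : numClosedFieldType) (U : lmodType C).
Variable form : {dot U for (@Num.conj C)}.

Lemma dot_CauchySchwarz (u v : U) :
  `|form u v| ^+ 2 <= form u u * form v v.
Proof.
have [->|v0] := eqVneq v 0.
  rewrite !linear0r normr0 expr0n /=.
  by [].
have vv : 0 < form v v by rewrite dnorm_gt0.
have vr : Num.conj (form v v) = form v v by apply/CrealP/ger0_real/ltW.
pose a := form u v / form v v.
have := dnorm_ge0 form (u - a *: v); rewrite dnormB dnormZ.
have -> : form u (a *: v) = `|form u v| ^+ 2 / form v v.
  rewrite linearZr_LR /= /a rmorphM /= fmorphV /= vr.
  by rewrite mulrAC -normCKC.
rewrite rmorphM fmorphV /= vr rmorphXn /=.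
have -> : Num.conj `|form u v| = `|form u v| by apply/CrealP/normr_real.
rewrite normrM normfV (ger0_norm (ltW vv)) exprMn exprVn.
have -> : `|form u v| ^+ 2 * form v v ^- 2 * form v v = `|form u v| ^+ 2 / form v v.
  by rewrite -mulrA expr2 invfM mulfVK ?gt_eqF.
by rewrite opprD addrA addrK subr_ge0 ler_pdivrMr.
Qed.

Lemma dot_sqrt_triangle (u v : U) :
  sqrtC (form (u + v) (u + v)) <= sqrtC (form u u) + sqrtC (form v v).
Proof.
have nn w : 0 <= sqrtC (form w w) by rewrite sqrtC_ge0 dnorm_ge0.
rewrite -(@ler_pXn2r _ 2) ?nnegrE ?addr_ge0//.
rewrite sqrrD !sqrtCK dnormD /= [leRHS]addrAC lerD2l.
have -> : form u v + Num.conj (form u v) = 'Re (form u v) *+ 2.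
  by rewrite ReE -mulr_natr mulfVK// pnatr_eq0.
have h : 'Re (form u v) <= sqrtC (form u u) * sqrtC (form v v).
  apply: (le_trans (leif_Re_Creal _)).
  rewrite -(@ler_pXn2r _ 2) ?nnegrE ?mulr_ge0//.
  by rewrite exprMn !sqrtCK dot_CauchySchwarz.
by rewrite !mulr2n lerD.
Qed.
End dot_norm.

Section bounded_operators.
Context (R : realType) (H : hilbertType R).

Definition bounded_op : {pred H -> H} :=
  [pred T | `[< linear T /\ exists M : R[i], forall u, `|T u| <= M * `|u| >]].

Record bop := Bop { bop_fun :> H -> H; _ : bop_fun \in bounded_op }.

HB.instance Definition _ := [isSub for bop_fun].
HB.instance Definition _ := [Choice of bop by <:].

Lemma bounded_op_submod : submod_closed bounded_op.
Proof.
split=> [|a S T].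
  rewrite inE; split; first by move=> a u v; rewrite scaler0 addr0.
  by exists 0 => u; rewrite mul0r normr0.
rewrite !inE => -[linS [M SM]] [linT [N TN]]; split.
  move=> b u v; rewrite /= !fctE linS linT !scalerDr !scalerA addrACA.
  by rewrite [a * b]mulrC.
exists (`|a| * M + N) => u; rewrite !fctE (le_trans (ler_normD _ _))// normrZ mulrDl.
by rewrite lerD// -mulrA ler_wpM2l.
Qed.

HB.instance Definition _ :=
  GRing.isSubmodClosed.Build _ _ bounded_op bounded_op_submod.
HB.instance Definition _ := [SubChoice_isSubLmodule of bop by <:].

Implicit Types S T : bop.

Lemma bop_ext S T : (forall u, S u = T u) -> S = T.
Proof. by move=> ST; apply/val_inj/funext. Qed.

Lemma bop_linear T : linear T.
Proof. by case: T => T /= /asboolP[]. Qed.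

HB.instance Definition _ T :=
  GRing.isLinear.Build R[i] H H _ (T : H -> H) (bop_linear T).

Definition opnorm T : R :=
  sup [set complex.Re `|T u| | u in [set u : H | `|u| <= 1]].

Lemma opnorm_has_ub T :
  has_ubound [set complex.Re `|T u| | u in [set u : H | `|u| <= 1]].
Proof.
have [M hM] : exists M : R[i], forall u, `|T u| <= M * `|u|.
  by case: T => T /= /asboolP[].
exists (complex.Re `|M|) => _ [v /= v1 <-].
have : `|T v| <= `|M|.
  have [->|v0] := eqVneq v 0; first by rewrite raddf0 normr0.
  have M0 : 0 <= M.
    by rewrite -(@pmulr_lge0 _ `|v|) ?normr_gt0// (le_trans _ (hM v)).
  by rewrite (le_trans (hM v))// ger0_norm// ler_piMr.
by rewrite lecE => /andP[].
Qed.

Lemma opnorm_bound T u : `|T u| <= (opnorm T)%:C * `|u|.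
Proof.
have [->|u0] := eqVneq u 0; first by rewrite raddf0 !normr0 mulr0.
have nu : 0 < `|u| by rewrite normr_gt0.
rewrite -ler_pdivrMr//.
have -> : `|T u| / `|u| = `|T (`|u|^-1 *: u)|.
  by rewrite linearZ/= normrZ normfV normr_id mulrC.
rewrite -[leLHS]RRe_real ?normr_real// lecR.
apply: (ub_le_sup (opnorm_has_ub T)); exists (`|u|^-1 *: u) => //=.
by rewrite normrZ normfV normr_id mulVf// gt_eqF.
Qed.

Lemma opnorm_le T (M : R[i]) :
  0 <= M -> (forall u, `|T u| <= M * `|u|) -> (opnorm T)%:C <= M.
Proof.
move=> M0 hM; rewrite -[M]RRe_real ?ger0_real// lecR.
apply: ge_sup; first by exists (complex.Re `|T 0|), 0 => //=; rewrite normr0.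
move=> _ [v /= v1 <-].
have : `|T v| <= M by rewrite (le_trans (hM v))// ler_piMr.
by rewrite lecE => /andP[].
Qed.

Lemma opnorm_ge0 T : 0 <= (opnorm T)%:C.
Proof.
rewrite lecR; apply: (ub_le_sup (opnorm_has_ub T)).
by exists 0; rewrite /= ?normr0// raddf0 normr0.
Qed.

Lemma opnorm_triangle S T :
  (opnorm (S + T))%:C <= (opnorm S)%:C + (opnorm T)%:C.
Proof.
apply: opnorm_le => [|u]; first by rewrite addr_ge0 ?opnorm_ge0.
by rewrite mulrDl (le_trans (ler_normD _ _))// lerD ?opnorm_bound.
Qed.

Lemma opnormZ (a : R[i]) T : (opnorm (a *: T))%:C = `|a| * (opnorm T)%:C.
Proof.
have h b S : (opnorm (b *: S))%:C <= `|b| * (opnorm S)%:C.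
  apply: opnorm_le => [|u]; first by rewrite mulr_ge0 ?opnorm_ge0.
  by rewrite normrZ -mulrA ler_wpM2l ?opnorm_bound.
apply/eqP; rewrite eq_le h/=.
have [->|a0] := eqVneq a 0; first by rewrite normr0 mul0r opnorm_ge0.
rewrite -ler_pdivlMl ?normr_gt0// -normfV.
by have := h a^-1 (a *: T); rewrite scalerA mulVf// scale1r.
Qed.

Lemma opnorm_eq0 T : (opnorm T)%:C = 0 -> T = 0.
Proof.
move=> T0; apply: bop_ext => u; apply/eqP; rewrite -normr_le0.
by rewrite (le_trans (opnorm_bound T u))// T0 mul0r.
Qed.

(* The norm of an R[i]-module takes its values in R[i]. *)
HB.instance Definition _ := @Lmodule_isNormed.Build R[i] bop
  (fun T => (opnorm T)%:C) opnorm_triangle opnormZ opnorm_eq0.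

Lemma bop_normE T : `|T| = (opnorm T)%:C. Proof. by []. Qed.

Lemma bop_comp_subproof S T : (fun u => S (T u)) \in bounded_op.
Proof.
apply/asboolP; split; first by move=> a u v; rewrite !linearP.
exists ((opnorm S)%:C * (opnorm T)%:C) => u.
by rewrite (le_trans (opnorm_bound S _))// -mulrA ler_wpM2l ?opnorm_ge0 ?opnorm_bound.
Qed.

Definition bop_comp S T : bop := Bop (bop_comp_subproof S T).

(* T is the adjoint of S. *)
Definition adjoint_op S T := forall u v : H, hdot (S u) v = hdot u (T v).

End bounded_operators.

Section sums.
Context (R : realType) (X : choiceType).
Implicit Types f g p q : X -> R.

Definition rsummable f := summable [set: X] (EFin \o f).

(* Unconditional sum of a summable family, as the difference of the sums of its
   positive and negative parts. *)
Definition rsum f : R :=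
  fine (\esum_(x in [set: X]) (EFin \o f)^\+%E x
        - \esum_(x in [set: X]) (EFin \o f)^\-%E x)%E.

Lemma rsummable_le f g : rsummable g -> (forall x, `|f x| <= g x) -> rsummable f.
Proof.
move=> sg fg; apply: le_lt_trans sg; apply: le_esum => x _ /=.
by rewrite lee_fin (le_trans (fg x))// ler_norm.
Qed.

Lemma rsummableD f g : rsummable f -> rsummable g -> rsummable (fun x => f x + g x).
Proof. by move=> sf sg; exact: summableD sf sg. Qed.

Lemma rsummable0 : rsummable (fun=> 0).
Proof. by rewrite /rsummable /summable esum1 ?ltry// => x _ /=; rewrite normr0. Qed.

Lemma esumZ_le (a : R) f : 0 <= a -> (forall x, 0 <= f x) ->
  (\esum_(x in [set: X]) (a * f x)%:E <=
    a%:E * \esum_(x in [set: X]) (f x)%:E)%E.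
Proof.
move=> a0 f0; apply: ge_ereal_sup => _ [A [finA _]] <-.
under eq_fsbigr do rewrite EFinM.
rewrite -ge0_mule_fsumr; last by move=> x; rewrite lee_fin.
apply: lee_wpmul2l; first by rewrite lee_fin.
by apply: ereal_sup_ubound; exists A.
Qed.

Lemma esumZ (a : R) f : 0 <= a -> (forall x, 0 <= f x) ->
  (\esum_(x in [set: X]) (a * f x)%:E =
    a%:E * \esum_(x in [set: X]) (f x)%:E)%E.
Proof.
move=> a0 f0; apply/eqP; rewrite eq_le esumZ_le//=.
have [->|an0] := eqVneq a 0.
  by rewrite mul0e esum_ge0// => x _; rewrite mul0r.
have ap : 0 < a by rewrite lt_neqAle eq_sym an0.
have h : (\esum_(x in [set: X]) (f x)%:E <=
    a^-1%:E * \esum_(x in [set: X]) (a * f x)%:E)%E.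
  apply: le_trans (esumZ_le _ _); rewrite ?invr_ge0//; last first.
    by move=> x; rewrite mulr_ge0.
  by apply: le_esum => x _; rewrite mulrA mulVf// mul1r.
have := lee_wpmul2l (_ : (0 <= a%:E)%E) h; rewrite lee_fin => /(_ a0).
by rewrite muleA -EFinM mulfV// mul1e.
Qed.

Lemma rsummableZ (a : R) f : rsummable f -> rsummable (fun x => a * f x).
Proof.
move=> sf; rewrite /rsummable /summable.
rewrite (_ : \esum_(x in _) _ = `|a|%:E * \esum_(x in [set: X]) `|f x|%:E)%E; last first.
  rewrite -esumZ//; apply: eq_esum => x _ /=.
  by rewrite normrM.
by apply: lte_mul_pinfty; rewrite ?lee_fin.
Qed.

Lemma rsummable_fin f : rsummable f -> (forall x, 0 <= f x) ->
  \esum_(x in [set: X]) (f x)%:E \is a fin_num.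
Proof.
move=> sf f0; rewrite ge0_fin_numE ?esum_ge0// => [|x _]; last by rewrite lee_fin.
apply: le_lt_trans sf; apply: le_esum => x _ /=.
by rewrite lee_fin ler_norm.
Qed.

Lemma rsum_ge0E f : (forall x, 0 <= f x) ->
  rsum f = fine (\esum_(x in [set: X]) (f x)%:E).
Proof.
move=> f0; rewrite /rsum [X in (_ - X)%E]esum1 ?sube0; last first.
  move=> x _; rewrite funenegE /=; apply/max_idPr.
  by rewrite lee_fin oppr_le0.
congr fine; apply: eq_esum => x _; rewrite funeposE /=; apply/max_idPl.
by rewrite lee_fin.
Qed.

Lemma rsumB p q : rsummable p -> rsummable q ->
  (forall x, 0 <= p x) -> (forall x, 0 <= q x) ->
  rsum (fun x => p x - q x) =
  fine (\esum_(x in [set: X]) (p x)%:E) - fine (\esum_(x in [set: X]) (q x)%:E).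
Proof.
move=> sp sq p0 q0; rewrite -fineB ?rsummable_fin//; congr fine.
by rewrite -(esumB sp sq)// => x _ /=; rewrite lee_fin.
Qed.

Let pos f x := Num.max (f x) 0.
Let neg f x := Num.max (- f x) 0.

Let posneg f x : f x = pos f x - neg f x.
Proof.
rewrite /pos /neg; have [h|h] := leP 0 (f x).
  by rewrite max_r ?oppr_le0// subr0.
by rewrite max_l ?oppr_ge0 ?ltW// sub0r opprK.
Qed.
Let pos_ge0 f x : 0 <= pos f x. Proof. by rewrite le_max lexx orbT. Qed.
Let neg_ge0 f x : 0 <= neg f x. Proof. by rewrite le_max lexx orbT. Qed.

Let pos_sum f : rsummable f -> rsummable (pos f).
Proof.
move=> sf; apply: (@rsummable_le _ (fun x => `|f x|)).
  by apply: le_lt_trans sf; apply: le_esum => x _ /=; rewrite normr_id.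
by move=> x; rewrite ger0_norm// ge_max ler_norm normr_ge0.
Qed.
Let neg_sum f : rsummable f -> rsummable (neg f).
Proof.
move=> sf; apply: (@rsummable_le _ (fun x => `|f x|)).
  by apply: le_lt_trans sf; apply: le_esum => x _ /=; rewrite normr_id.
by move=> x; rewrite ger0_norm// ge_max -normrN ler_norm normr_ge0.
Qed.

Let esumD_fine p q : rsummable p -> rsummable q ->
  (forall x, 0 <= p x) -> (forall x, 0 <= q x) ->
  fine (\esum_(x in [set: X]) (p x + q x)%:E) =
  fine (\esum_(x in [set: X]) (p x)%:E) + fine (\esum_(x in [set: X]) (q x)%:E).
Proof.
move=> sp sq p0 q0; rewrite -fineD ?rsummable_fin//; congr fine.
by rewrite -esumD// => x _; rewrite lee_fin.
Qed.

Let rsum_posneg f : rsummable f ->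
  rsum f = fine (\esum_(x in [set: X]) (pos f x)%:E)
         - fine (\esum_(x in [set: X]) (neg f x)%:E).
Proof.
move=> sf; rewrite -(rsumB (pos_sum sf) (neg_sum sf) (pos_ge0 f) (neg_ge0 f)).
by congr rsum; apply/funext => x; exact: posneg.
Qed.

Lemma rsumD f g : rsummable f -> rsummable g ->
  rsum (fun x => f x + g x) = rsum f + rsum g.
Proof.
move=> sf sg.
have -> : (fun x => f x + g x) =
    (fun x => (pos f x + pos g x) - (neg f x + neg g x)).
  by apply/funext => x; rewrite (posneg f) (posneg g) opprD addrACA.
rewrite (rsumB (rsummableD (pos_sum sf) (pos_sum sg))
  (rsummableD (neg_sum sf) (neg_sum sg))); last 2 first.
- by move=> x; rewrite addr_ge0.
- by move=> x; rewrite addr_ge0.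
rewrite (esumD_fine (pos_sum sf) (pos_sum sg))//.
rewrite (esumD_fine (neg_sum sf) (neg_sum sg))//.
by rewrite (rsum_posneg sf) (rsum_posneg sg) opprD addrACA.
Qed.

Lemma rsumN f : rsummable f -> rsum (fun x => - f x) = - rsum f.
Proof.
move=> sf.
have -> : (fun x => - f x) = (fun x => neg f x - pos f x).
  by apply/funext => x; rewrite [in LHS](posneg f) opprB.
rewrite (rsumB (neg_sum sf) (pos_sum sf) (neg_ge0 f) (pos_ge0 f)).
by rewrite (rsum_posneg sf) opprB.
Qed.

Let esumZ_fine (a : R) p : rsummable p -> 0 <= a -> (forall x, 0 <= p x) ->
  fine (\esum_(x in [set: X]) (a * p x)%:E) =
  a * fine (\esum_(x in [set: X]) (p x)%:E).
Proof. by move=> sp a0 p0; rewrite esumZ// fineM// rsummable_fin. Qed.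

Lemma rsumZ a f : rsummable f -> rsum (fun x => a * f x) = a * rsum f.
Proof.
have rsumZ_ge0 (b : R) : 0 <= b -> rsummable f ->
    rsum (fun x => b * f x) = b * rsum f.
  move=> b0 sf.
  have -> : (fun x => b * f x) = (fun x => b * pos f x - b * neg f x).
    by apply/funext => x; rewrite [in LHS](posneg f) mulrBr.
  rewrite (rsumB (rsummableZ b (pos_sum sf)) (rsummableZ b (neg_sum sf)));
    last 2 first.
  - by move=> x; rewrite mulr_ge0.
  - by move=> x; rewrite mulr_ge0.
  rewrite (esumZ_fine (pos_sum sf))// (esumZ_fine (neg_sum sf))//.
  by rewrite (rsum_posneg sf) mulrBr.
move=> sf; have [a0|a0] := leP 0 a; first exact: rsumZ_ge0.
have -> : (fun x => a * f x) = (fun x => - ((- a) * f x)).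
  by apply/funext => x; rewrite mulNr opprK.
rewrite (rsumN (rsummableZ (- a) sf)) rsumZ_ge0// ?oppr_ge0 ?ltW//.
by rewrite mulNr opprK.
Qed.

End sums.

Section complex_sums.
Context (R : realType) (X : choiceType).
Implicit Types h k : X -> R[i].

Definition csummable h :=
  rsummable (fun x => complex.Re (h x)) /\ rsummable (fun x => complex.Im (h x)).

Definition csum h : R[i] :=
  rsum (fun x => complex.Re (h x)) +i* rsum (fun x => complex.Im (h x)).

Lemma csummableD h k : csummable h -> csummable k ->
  csummable (fun x => h x + k x).
Proof.
move=> [hr hi] [kr ki]; split.
  by have := rsummableD hr kr; congr rsummable; apply/funext => x; rewrite raddfD.
by have := rsummableD hi ki; congr rsummable; apply/funext => x; rewrite raddfD.
Qed.

Lemma csumD h k : csummable h -> csummable k ->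
  csum (fun x => h x + k x) = csum h + csum k.
Proof.
move=> [hr hi] [kr ki]; apply/eqP; rewrite eq_complex /= -!rsumD//.
by apply/andP; split; apply/eqP; congr rsum; apply/funext => x; rewrite raddfD.
Qed.

Let ReM (a z : R[i]) : complex.Re (a * z) =
  complex.Re a * complex.Re z + (- complex.Im a) * complex.Im z.
Proof. by case: a z => [a b] [c d]; rewrite /= mulNr. Qed.
Let ImM (a z : R[i]) : complex.Im (a * z) =
  complex.Re a * complex.Im z + complex.Im a * complex.Re z.
Proof. by case: a z => [a b] [c d]; rewrite /= . Qed.

Lemma csummableZ a h : csummable h -> csummable (fun x => a * h x).
Proof.
move=> [hr hi]; split.
  rewrite (funext (fun x => ReM a (h x))).
  by apply: rsummableD; exact: rsummableZ.
rewrite (funext (fun x => ImM a (h x))).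
by apply: rsummableD; exact: rsummableZ.
Qed.

Lemma csumZ a h : csummable h -> csum (fun x => a * h x) = a * csum h.
Proof.
move=> [hr hi]; apply/eqP; rewrite eq_complex ReM ImM /=.
rewrite (funext (fun x => ReM a (h x))) (funext (fun x => ImM a (h x))).
by rewrite !rsumD ?rsumZ ?eqxx//; exact: rsummableZ.
Qed.

Lemma csum_conj h : csummable h -> csum (fun x => Num.conj (h x)) = Num.conj (csum h).
Proof.
move=> [hr hi]; apply/eqP; rewrite eq_complex /= -rsumN//.
by apply/andP; split; apply/eqP; congr rsum; apply/funext => x; case: (h x).
Qed.

End complex_sums.

Section normc.
Context (R : realType).

Lemma normc2E (z : R[i]) : normc z ^+ 2 = complex.Re z ^+ 2 + complex.Im z ^+ 2.
Proof. by case: z => a b; rewrite /normc sqr_sqrtr// addr_ge0// sqr_ge0. Qed.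

Lemma normc_ge0 (z : R[i]) : 0 <= normc z.
Proof. by case: z => a b; exact: sqrtr_ge0. Qed.

End normc.

Section l2.
Context (R : realType) (X : choiceType).

Definition square_summable : {pred X -> R[i]} :=
  [pred f | `[< rsummable (fun x => normc (f x) ^+ 2) >]].

Record l2 := L2 { l2_fun :> X -> R[i]; _ : l2_fun \in square_summable }.

HB.instance Definition _ := [isSub for l2_fun].
HB.instance Definition _ := [Choice of l2 by <:].

Let normM_le (a b c d : R) :
  `|a * c + b * d| <= a ^+ 2 + b ^+ 2 + (c ^+ 2 + d ^+ 2).
Proof.
have := (sqr_ge0 (a + c), sqr_ge0 (a - c), sqr_ge0 (b + d), sqr_ge0 (b - d)).
have := (sqr_ge0 a, sqr_ge0 b, sqr_ge0 c, sqr_ge0 d).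
by move=> [[[? ?] ?] ?] [[[? ?] ?] ?]; rewrite ler_norml; apply/andP; split; lra.
Qed.

Lemma square_summable_submod : submod_closed square_summable.
Proof.
split=> [|a f g].
  rewrite inE; have := @rsummable0 R X; congr rsummable; apply/funext => x.
  by rewrite normc0 expr0n.
rewrite !inE => sf sg.
have s := rsummableZ 2 (rsummableD (rsummableZ (normc a ^+ 2) sf) sg).
apply: rsummable_le s _ => x /=.
rewrite ger0_norm ?sqr_ge0// !fctE -exprMn -normcM.
have := sqr_ge0 (normc (a * f x) - normc (g x)).
have : normc (a * f x + g x) ^+ 2 <= (normc (a * f x) + normc (g x)) ^+ 2.
  by rewrite ler_pXn2r ?nnegrE ?addr_ge0 ?le_normcD ?normc_ge0.
rewrite -[a *: f x]/(a * f x); nra.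
Qed.

HB.instance Definition _ :=
  GRing.isSubmodClosed.Build _ _ square_summable square_summable_submod.
HB.instance Definition _ := [SubChoice_isSubLmodule of l2 by <:].

Implicit Types f g h : l2.

Lemma l2_ext f g : (forall x, f x = g x) -> f = g.
Proof. by move=> fg; apply/val_inj/funext. Qed.

Lemma l2_summable f : rsummable (fun x => normc (f x) ^+ 2).
Proof. by case: f => f /= /asboolP. Qed.

Definition l2_dot f g : R[i] := csum (fun x => f x * Num.conj (g x)).

Lemma l2_dot_summable f g : csummable (fun x => f x * Num.conj (g x)).
Proof.
have s := rsummableD (l2_summable f) (l2_summable g).
split; apply: rsummable_le s _ => x /=; rewrite !normc2E;
  case: (f x) (g x) => [a b] [c d] /=.
  by rewrite mulrN opprK; exact: normM_le.
by have := normM_le a b (- d) c; rewrite sqrrN [d ^+ 2 + _]addrC.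
Qed.

Let l2_dot_linearl h : linear_for *%R (l2_dot^~ h).
Proof.
move=> a f g; rewrite /l2_dot -csumZ; last exact: l2_dot_summable.
rewrite -csumD; [|exact/csummableZ/l2_dot_summable|exact: l2_dot_summable].
by congr csum; apply/funext => x /=; rewrite mulrDl mulrA.
Qed.

Let l2_dot_conj f g : l2_dot f g = Num.conj (l2_dot g f).
Proof.
rewrite /l2_dot -csum_conj; last exact: l2_dot_summable.
by congr csum; apply/funext => x; rewrite rmorphM /= conjCK mulrC.
Qed.

Let l2_dot_linearr h : linear_for (Num.conj \; *%R) (l2_dot h).
Proof.
move=> a f g; rewrite l2_dot_conj l2_dot_linearl rmorphD rmorphM /=.
by rewrite -!l2_dot_conj.
Qed.

Lemma l2_dotE f : l2_dot f f =
  (fine (\esum_(x in [set: X]) (normc (f x) ^+ 2)%:E))%:C.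
Proof.
rewrite -rsum_ge0E; last by move=> x; rewrite sqr_ge0.
apply/eqP; rewrite eq_complex /=; apply/andP; split; apply/eqP.
  by congr rsum; apply/funext => x; rewrite normc2E; case: (f x) => a b /=; lra.
rewrite rsum_ge0E; last by move=> x; case: (f x) => a b /=; lra.
by rewrite esum1// => x _; case: (f x) => a b /=; congr EFin; lra.
Qed.

Let l2_dot_bilinear : bilinear_for *%R (Num.conj \; *%R) l2_dot.
Proof. by split; [exact: l2_dot_linearl | exact: l2_dot_linearr]. Qed.

HB.instance Definition _ := bilinear_isBilinear.Build R[i] l2 l2 R[i] *%R
  (Num.conj \; *%R) l2_dot l2_dot_bilinear.

Let l2_dot_hermitian f g :
  l2_dot f g = (-1) ^+ false * Num.conj (l2_dot g f).
Proof. by rewrite expr0 mul1r. Qed.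

HB.instance Definition _ := isHermitianSesquilinear.Build R[i] l2 false
  (@Num.conj R[i]) l2_dot l2_dot_hermitian.

Lemma l2_finE f : \esum_(x in [set: X]) (normc (f x) ^+ 2)%:E \is a fin_num.
Proof. by apply: rsummable_fin (l2_summable f) _ => x; rewrite sqr_ge0. Qed.

Let l2_dot_gt0 f : f != 0 -> 0 < l2_dot f f.
Proof.
move=> f0; have [x fx] : exists x, f x != 0.
  apply/not_existsP => h; move/eqP: f0; apply; apply: l2_ext => x.
  by apply/eqP/negPn/negP; exact: h.
rewrite l2_dotE ltcR -lte_fin fineK ?l2_finE//.
apply: (@lt_le_trans _ _ (normc (f x) ^+ 2)%:E).
  rewrite lte_fin exprn_gt0// lt_neqAle normc_ge0 andbT eq_sym.
  by apply: contra fx => /eqP/eq0_normc ->.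
rewrite -(@esum_set1 R X x (fun x => (normc (f x) ^+ 2)%:E)) ?lee_fin ?sqr_ge0//.
rewrite [leRHS](esumID [set x])//; last by move=> y _; rewrite lee_fin sqr_ge0.
by rewrite setTI leeDl// esum_ge0// => y _; rewrite lee_fin sqr_ge0.
Qed.

HB.instance Definition _ := isDotProduct.Build R[i] l2 l2_dot l2_dot_gt0.

Definition l2_norm f : R[i] := sqrtC (l2_dot f f).

Let l2_triangle f g : l2_norm (f + g) <= l2_norm f + l2_norm g.
Proof. exact: (dot_sqrt_triangle l2_dot). Qed.

Let l2_normZ (a : R[i]) f : l2_norm (a *: f) = `|a| * l2_norm f.
Proof.
by rewrite /l2_norm (@dnormZ _ _ l2_dot) sqrtCM ?sqrCK ?nnegrE ?exprn_ge0//.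
Qed.

Let l2_norm_eq0 f : l2_norm f = 0 -> f = 0.
Proof. by move/eqP; rewrite sqrtC_eq0 (dnorm_eq0 l2_dot) => /eqP. Qed.

HB.instance Definition _ := @Lmodule_isNormed.Build R[i] l2
  l2_norm l2_triangle l2_normZ l2_norm_eq0.

Lemma l2_norm2 f : `|f| ^+ 2 =
  (fine (\esum_(x in [set: X]) (normc (f x) ^+ 2)%:E))%:C.
Proof. by rewrite [`|f|]/(l2_norm f) sqrtCK l2_dotE. Qed.

End l2.

Section l2_complete.
Context (R : realType) (X : choiceType).
Implicit Types f g : l2 R X.

Lemma square_summableP (h : X -> R[i]) (M : R) :
  (forall s : seq X, uniq s -> \sum_(x <- s) normc (h x) ^+ 2 <= M) ->
  h \in @square_summable R X /\
  fine (\esum_(x in [set: X]) (normc (h x) ^+ 2)%:E) <= M.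
Proof.
move=> hM.
have le : (\esum_(x in [set: X]) (normc (h x) ^+ 2)%:E <= M%:E)%E.
  apply: ge_ereal_sup => _ [A [finA _]] <-.
  by rewrite fsumEFin// lee_fin fsbig_finite// hM.
have fin : \esum_(x in [set: X]) (normc (h x) ^+ 2)%:E \is a fin_num.
  rewrite ge0_fin_numE ?(le_lt_trans le) ?ltry// esum_ge0// => x _.
  by rewrite lee_fin sqr_ge0.
split; last by rewrite -lee_fin fineK.
rewrite inE /rsummable /summable (le_lt_trans _ (ltry M))// (le_trans _ le)//.
by apply: le_esum => x _ /=; rewrite ger0_norm// sqr_ge0.
Qed.

Lemma l2_norm_le f (e : R) : 0 <= e ->
  (forall s : seq X, uniq s -> \sum_(x <- s) normc (f x) ^+ 2 <= e ^+ 2) ->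
  `|f| <= e%:C.
Proof.
move=> e0 /square_summableP[_ fe].
rewrite -(@ler_pXn2r _ 2) ?nnegrE ?lecR// l2_norm2.
by rewrite -rmorphXn /= lecR.
Qed.

Lemma l2_sum_le f (e : R) (s : seq X) : uniq s -> `|f| <= e%:C ->
  \sum_(x <- s) normc (f x) ^+ 2 <= e ^+ 2.
Proof.
move=> us fe.
have : `|f| ^+ 2 <= e%:C ^+ 2 by rewrite ler_pXn2r ?nnegrE ?(le_trans _ fe).
rewrite l2_norm2 -rmorphXn /= lecR; apply: le_trans.
rewrite -lee_fin fineK ?l2_finE//; apply: esum_ge.
exists [set` s]; first by split.
by rewrite fsumEFin// lee_fin fsbig_seq.
Qed.

Lemma l2_coord_le f x : (normc (f x))%:C <= `|f|.
Proof.
have fr : `|f| = (complex.Re `|f|)%:C by rewrite RRe_real.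
have e0 : 0 <= complex.Re `|f| by rewrite -lecR -fr; exact: normr_ge0.
have := @l2_sum_le f (complex.Re `|f|) [:: x] isT.
rewrite -fr lexx => /(_ isT); rewrite big_seq1.
by rewrite ler_pXn2r ?nnegrE ?normc_ge0// => h; rewrite fr lecR.
Qed.

Lemma l2_complete (F : set_system (l2 R X)) :
  ProperFilter F -> cauchy F -> cvg F.
Proof.
move=> FF /cauchyP Fc.
have Fc' (e : R) : 0 < e ->
    exists f0, F [set f | `|f0 - f| < e%:C].
  move=> e0; have [|f0 Ff0] := Fc e%:C; first by rewrite ltcR.
  by exists f0; move: Ff0; rewrite -ball_normE.
have coord (p : R[i] -> R) : (forall z w, p z - p w = p (z - w)) ->
    (forall z, `|p z| <= normc z) ->
    forall x, cvg ((fun f : l2 R X => p (f x)) @ F).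
  move=> pB ple x; apply: R_complete; apply/cauchyP => e e0.
  have [f0 Ff0] := Fc' e e0; exists (p (f0 x)).
  suff : F [set f : l2 R X | `|p (f0 x) - p (f x)| < e] by [].
  apply: filterS Ff0 => f /= fe; rewrite pB -ltcR.
  apply: le_lt_trans fe; rewrite (le_trans _ (l2_coord_le _ x))// lecR.
  exact: ple.
have cRe := coord (@complex.Re R).
have cIm := coord (@complex.Im R).
have {}cRe x : cvg ((fun f : l2 R X => complex.Re (f x)) @ F).
  apply: cRe => [z w|[a b]]; first by rewrite raddfB.
  rewrite -(@ler_pXn2r _ 2) ?nnegrE ?normc_ge0// real_normK ?num_real//.
  by rewrite normc2E lerDl sqr_ge0.
have {}cIm x : cvg ((fun f : l2 R X => complex.Im (f x)) @ F).
  apply: cIm => [z w|[a b]]; first by rewrite raddfB.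
  rewrite -(@ler_pXn2r _ 2) ?nnegrE ?normc_ge0// real_normK ?num_real//.
  by rewrite normc2E lerDr sqr_ge0.
pose l x : R[i] := lim ((fun f : l2 R X => complex.Re (f x)) @ F)
                +i* lim ((fun f : l2 R X => complex.Im (f x)) @ F).
have lcvg (g : l2 R X) (s : seq X) :
    \sum_(x <- s) normc ((f : l2 R X) x - g x) ^+ 2 @[f --> F] -->
    \sum_(x <- s) normc (l x - g x) ^+ 2.
  elim: s => [|x s IH].
    rewrite big_nil (_ : (fun f => _) = (fun=> 0)); first exact: cvg_cst.
    by apply/funext => f; rewrite big_nil.
  rewrite big_cons (_ : (fun f => _) = (fun f : l2 R X =>
    normc (f x - g x) ^+ 2 + \sum_(x <- s) normc (f x - g x) ^+ 2)); last first.
    by apply/funext => f; rewrite big_cons.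
  apply: cvgD => //; rewrite normc2E.
  rewrite (_ : (fun f => _) = (fun f : l2 R X =>
    (complex.Re (f x) - complex.Re (g x)) ^+ 2 +
    (complex.Im (f x) - complex.Im (g x)) ^+ 2)); last first.
    by apply/funext => f; rewrite normc2E !raddfB.
  rewrite !raddfB; apply: cvgD; rewrite expr2.
    by apply: cvgM; apply: cvgB; [exact: cRe|exact: cvg_cst
                                 |exact: cRe|exact: cvg_cst].
  by apply: cvgM; apply: cvgB; [exact: cIm|exact: cvg_cst
                               |exact: cIm|exact: cvg_cst].
have key (e : R) : 0 < e -> F [set g : l2 R X |
    forall s : seq X, uniq s -> \sum_(x <- s) normc (l x - g x) ^+ 2 <= e ^+ 2].
  move=> e0; have [|f0 Ff0] := Fc' (e / 2); first by rewrite divr_gt0.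
  apply: filterS (Ff0) => g /= ge s us.
  have := @closed_cvg _ _ F _ _ (fun r : R => r <= e ^+ 2) (@closed_le _ _) _ _
    (lcvg g s).
  apply; apply: filterS (Ff0) => f /= fe; apply: (@l2_sum_le (f - g)) => //.
  rewrite -(subrKA f0) (splitr e) rmorphD /=.
  rewrite (le_trans (ler_normD _ _))// lerD// ?ltW//.
  by rewrite distrC.
have inl : l \in @square_summable R X.
  have /filter_ex[g /= hg] := key 1 ltr01.
  have [lg _] := square_summableP hg.
  rewrite (_ : l = (fun x => l x - g x) + (g : X -> R[i])).
    by rewrite rpredD//; case: (g).
  by apply/funext => x; rewrite !fctE subrK.
apply/cvg_ex; exists (L2 inl); apply/cvgrPdist_le => e e0.
have eE : e = (complex.Re e)%:C by rewrite RRe_real// gtr0_real.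
have Re0 : 0 < complex.Re e by rewrite -ltcR -eE.
apply: filterS (key _ Re0) => g /= hg.
by rewrite eE; apply: l2_norm_le => //; exact: ltW.
Qed.

HB.instance Definition _ := Uniform_isComplete.Build (l2 R X) l2_complete.

HB.instance Definition _ := isHilbert.Build R (l2 R X)
  (fun f => esym (sqrtCK (l2_dot f f))).

End l2_complete.


Section l2_delta.
Context (R : realType) (X : choiceType).

Lemma l2_delta_subproof (y : X) :
  (fun x => (x == y)%:R : R[i]) \in @square_summable R X.
Proof.
apply: (proj1 (@square_summableP R X _ 1 _)) => s us.
have normcb (b : bool) : normc (b%:R : R[i]) ^+ 2 = b%:R.
  by case: b; rewrite ?normc1 ?normc0 ?expr1n ?expr0n.
under eq_bigr do rewrite normcb.
have [ys|ys] := boolP (y \in s).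
  rewrite (bigD1_seq y)//= eqxx big1 ?addr0// => x xy.
  by rewrite (negbTE xy).
rewrite big_seq big1 ?ler01// => x xs.
by case: eqP => // xy; rewrite xy (negbTE ys) in xs.
Qed.

Definition l2_delta (y : X) : l2 R X := L2 (l2_delta_subproof y).

Definition op_matrix (T : bop (l2 R X)) (x y : X) : R[i] := T (l2_delta y) x.

End l2_delta.

Section operator_algebras.
Context (R : realType).
Implicit Types H K : hilbertType R.

(* Positivity of the operator that the operator matrix T defines on the
   Hilbert space H^n, that is, <T xi, xi> >= 0 for all xi in H^n. *)
Definition positive_op_matrix H n (T : 'M[bop H]_n) : Prop :=
  forall xi : 'I_n -> H, 0 <= \sum_i \sum_j hdot (T i j (xi j)) (xi i).

(* In what follows a C*-algebra is given as a norm-closed *-subalgebra A of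
   the bounded operators on a Hilbert space H, and a map out of A as a function
   on all of [bop H] whose values outside A are irrelevant. *)

Definition linear_on H K (A : set (bop H)) (phi : bop H -> bop K) : Prop :=
  forall (c : R[i]) (a b : bop H), A a -> A b ->
    phi (c *: a + b) = c *: phi a + phi b.

Definition completely_positive H K (A : set (bop H)) (phi : bop H -> bop K) :
    Prop :=
  forall n (T : 'M[bop H]_n), (forall i j, A (T i j)) ->
    positive_op_matrix T -> positive_op_matrix (map_mx phi T).

Definition ccp_map H K (A : set (bop H)) (B : set (bop K))
    (phi : bop H -> bop K) : Prop :=
  [/\ forall a, A a -> B (phi a), linear_on A phi, completely_positive A phi
    & forall a, A a -> `|phi a| <= `|a|].

(* theta : A -> B is nuclear if it is a point-norm limit of composites
   A -> M_k(C) -> B of contractive completely positive maps; the matrix algebra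
   M_k(C) is the algebra of all operators on l2({0, ..., k-1}). *)
Definition nuclear_map H K (A : set (bop H)) (B : set (bop K))
    (theta : bop H -> bop K) : Prop :=
  forall (F : set (bop H)) (e : R), finite_set F -> F `<=` A -> 0 < e ->
    exists (k : nat) (phi : bop H -> bop (l2 R 'I_k))
        (psi : bop (l2 R 'I_k) -> bop K),
      [/\ ccp_map A setT phi, ccp_map setT B psi
        & forall a, F a -> `|psi (phi a) - theta a| < e%:C].

Definition star_representation H K (A : set (bop H)) (rho : bop H -> bop K) :
    Prop :=
  [/\ linear_on A rho,
      forall a b, A a -> A b -> rho (bop_comp a b) = bop_comp (rho a) (rho b)
    & forall a b, A a -> A b -> adjoint_op a b -> adjoint_op (rho a) (rho b)].

(* A is nuclear if its identity map is nuclear, and exact if it has a faithful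
   representation A -> B(K) that is nuclear as a map into B(K). *)
Definition nuclear_algebra H (A : set (bop H)) : Prop := nuclear_map A A id.

Definition exact_algebra H (A : set (bop H)) : Prop :=
  exists (K : hilbertType R) (rho : bop H -> bop K),
    [/\ star_representation A rho,
        forall a b, A a -> A b -> rho a = rho b -> a = b
      & nuclear_map A setT rho].

End operator_algebras.

Section coarse_geometry.
Context (R : realType).
Implicit Types X Y : metricType R.

Definition uniformly_discrete X : Prop :=
  exists2 c : R, 0 < c & forall x y : X, x <> y -> c <= mdist x y.

Definition bounded_geometry X : Prop :=
  forall r : R, 0 < r ->
    exists N : nat, forall x : X, (ball x r #<= `I_N)%card.

Definition metrically_bounded X (B : set X) : Prop :=
  exists M : R, forall x y, B x -> B y -> mdist x y <= M.

Definition coarse_map X Y (f : X -> Y) : Prop :=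
  (forall r : R, exists s : R, forall x x' : X,
     mdist x x' <= r -> mdist (f x) (f x') <= s) /\
  (forall B : set Y, metrically_bounded B -> metrically_bounded (f @^-1` B)).

Definition close_maps X Y (f g : X -> Y) : Prop :=
  exists M : R, forall x, mdist (f x) (g x) <= M.

Definition coarsely_equivalent X Y : Prop :=
  exists (f : X -> Y) (g : Y -> X),
    [/\ coarse_map f, coarse_map g, close_maps (g \o f) id
      & close_maps (f \o g) id].

Definition finite_propagation X (T : bop (l2 R X)) : Prop :=
  exists2 r : R, 0 <= r & forall x y : X, r < mdist x y -> op_matrix T x y = 0.

Definition uniform_roe X : set (bop (l2 R X)) :=
  closure [set T | finite_propagation T].

End coarse_geometry.

Arguments uniform_roe {R} X _.

(* Main.v *)
Require Import Defs.
From HB Require Import structures.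
From mathcomp Require Import all_boot all_order all_algebra.
From mathcomp Require Import all_classical all_reals all_analysis.
From mathcomp Require Import complex ring.

(** The uniform Roe algebras of coarsely equivalent spaces are Morita
    equivalent, and the proof below carries nuclearity and exactness across
    that equivalence by explicit matrices.

    A coarse equivalence f : Y -> X has fibers of uniformly bounded diameter,
    because a coarse inverse moves every point of Y a bounded distance.  By
    bounded geometry of Y these fibers have at most n points, so the points of
    Y can be labelled by {0, ..., n-1} in such a way that y |-> (label y, f y)
    is injective ([coarse_labelling]).  This injection is an isometry V of
    l2(Y) into the n-fold power of l2(X), with components V_i.  Since f and its
    coarse inverse distort distances in a controlled way, all the entries
    V_i T V_j^* of an operator T of C*_u(Y) lie in C*_u(X)
    ([corner_uniform_roe]) and, conversely, sum_ij V_i^* S_ij V_j lies in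
    C*_u(Y) when all the S_ij lie in C*_u(X) ([assemble_uniform_roe]).  As
    V^* V = 1, disassembling T and reassembling its entries gives T back, so
    C*_u(Y) is a corner of the n x n matrices over C*_u(X).

    Let now phi : C*_u(X) -> M_k and psi : M_k -> C be contractive completely
    positive with psi o phi close to a map theta.  Applying phi and psi to each
    entry gives C*_u(Y) -> M_nk -> M_n(C), and reassembling the result gives an
    approximation of the amplification of theta ([amplify_nuclear]).  Complete
    positivity is inherited because a positive matrix of operators on l2(Y) has
    a positive matrix of matrices of entries ([amplify_cp]).  Contractivity is
    not inherited entry by entry; it follows from complete positivity and the
    value at 1, by the classical argument that applies the map to the positive
    matrix with diagonal |a| 1 and off-diagonal entries a and a^*
    ([cp_contractive]).

    For nuclearity, theta is the identity of C*_u(X) and its amplification is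
    the identity of C*_u(Y).  For exactness, theta is a faithful representation
    rho on K which is nuclear as a map into B(K); its amplification is the
    representation T |-> [rho (V_i T V_j^* )] on the n-fold power of K, which
    is again multiplicative, involutive, faithful and nuclear.

    Coarse equivalence is symmetric, so one implication gives both. *)

Set Implicit Arguments.
Unset Strict Implicit.
Unset Printing Implicit Defensive.

Import Order.TTheory GRing.Theory Num.Theory.
Import numFieldNormedType.Exports Normc.

Local Open Scope classical_set_scope.
Local Open Scope ring_scope.
Local Open Scope complex_scope.

(** * Operators and operator systems *)

Section operator_systems.
Context (R : realType).
Implicit Types H K : hilbertType R.

Lemma hdotC H (u v : H) : hdot u v = Num.conj (hdot v u).
Proof. by rewrite hermC expr0 mul1r. Qed.

Lemma hdot_CauchySchwarz H (u v : H) : `|hdot u v| <= `|u| * `|v|.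
Proof.
rewrite -(@ler_pXn2r _ 2) ?nnegrE ?mulr_ge0// exprMn -!hdot_norm.
exact: dot_CauchySchwarz.
Qed.

(** It makes passing to adjoints nonexpansive, hence compatible with closures. *)
Lemma adjoint_op_norm H (a b : bop H) : adjoint_op a b -> `|b| <= `|a|.
Proof.
move=> ab; rewrite bop_normE; apply: opnorm_le => // v.
have [->|b0] := eqVneq (b v) 0; first by rewrite normr0 mulr_ge0.
rewrite -(@ler_pM2r _ `|b v|) ?normr_gt0//.
have -> : `|b v| * `|b v| = `|hdot (a (b v)) v|.
  by rewrite ab hdot_norm ger0_norm ?exprn_ge0.
rewrite (le_trans (hdot_CauchySchwarz _ _))// -mulrA (mulrC `|v|) mulrA.
by rewrite ler_wpM2r// opnorm_bound.
Qed.

Lemma bop_id_subproof H : (fun u : H => u) \in @bounded_op R H.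
Proof. by apply/asboolP; split=> //; exists 1 => u; rewrite mul1r. Qed.

Definition bop_id H : bop H := Bop (bop_id_subproof H).

Lemma bop_id_norm H : `|bop_id H| <= 1.
Proof. by rewrite bop_normE; apply: opnorm_le => // u; rewrite mul1r. Qed.

Lemma bop_comp_norm H (a b : bop H) : `|bop_comp a b| <= `|a| * `|b|.
Proof.
rewrite bop_normE; apply: opnorm_le => [|u]; first by rewrite mulr_ge0.
rewrite -mulrA (le_trans (opnorm_bound a _))// -bop_normE ler_wpM2l//.
exact: opnorm_bound.
Qed.

(** The structure on the domain of a completely positive map by which its value
    at 1 controls its norm, see [cp_contractive]. *)
Definition operator_system H (A : set (bop H)) : Prop :=
  [/\ A (bop_id H), forall (c : R[i]) a b, A a -> A b -> A (c *: a + b)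
    & forall a, A a -> exists2 b, A b & adjoint_op a b].

Section operator_system_closed.
Context H (A : set (bop H)) (sysA : operator_system A).

Lemma operator_system0 : A 0.
Proof.
by case: sysA => A1 AL _; have := AL (-1) _ _ A1 A1; rewrite scaleN1r addNr.
Qed.

Lemma operator_systemZ (c : R[i]) a : A a -> A (c *: a).
Proof.
case: sysA => _ AL _ Aa; have := AL c _ _ Aa operator_system0.
by rewrite addr0.
Qed.

Lemma operator_systemD a b : A a -> A b -> A (a + b).
Proof.
by case: sysA => _ AL _ Aa Ab; have := AL 1 _ _ Aa Ab; rewrite scale1r.
Qed.

Lemma operator_system_sum (I : finType) (a : I -> bop H) :
  (forall i, A (a i)) -> A (\sum_i a i).
Proof.
move=> Aa; apply: big_ind => // [|? ?]; first exact: operator_system0.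
exact: operator_systemD.
Qed.

End operator_system_closed.

Lemma bop_sumE H (I : Type) (r : seq I) (P : pred I) (a : I -> bop H) u :
  (\sum_(i <- r | P i) a i) u = \sum_(i <- r | P i) a i u.
Proof. by elim/big_rec2 : _ => // i y1 y2 _ <-. Qed.

Section linear_on.
Context H K (A : set (bop H)) (phi : bop H -> bop K).
Hypotheses (sysA : operator_system A) (lin : linear_on A phi).

Lemma linear_on0 : phi 0 = 0.
Proof.
have := lin (-1) (operator_system0 sysA) (operator_system0 sysA).
by rewrite scaleN1r addNr scaleN1r addNr.
Qed.

Lemma linear_onZ (c : R[i]) a : A a -> phi (c *: a) = c *: phi a.
Proof.
move=> Aa; have := lin c Aa (operator_system0 sysA).
by rewrite !addr0 linear_on0 addr0.
Qed.

Lemma linear_onD a b : A a -> A b -> phi (a + b) = phi a + phi b.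
Proof. by move=> Aa Ab; have := lin 1 Aa Ab; rewrite !scale1r. Qed.

Lemma linear_onB a b : A a -> A b -> phi (a - b) = phi a - phi b.
Proof.
move=> Aa Ab; rewrite -(scaleN1r b) -(scaleN1r (phi b)) -linear_onZ//.
by rewrite linear_onD//; exact: operator_systemZ.
Qed.

Lemma linear_on_sum (I : finType) (a : I -> bop H) :
  (forall i, A (a i)) -> phi (\sum_i a i) = \sum_i phi (a i).
Proof.
move=> Aa.
suff [] : A (\sum_i a i) /\ phi (\sum_i a i) = \sum_i phi (a i) by [].
elim/big_rec2 : _ => [|i y1 y2 _ [Ay <-]].
  by split; [exact: operator_system0 | exact: linear_on0].
by rewrite linear_onD//; split=> //; exact: operator_systemD.
Qed.

End linear_on.

End operator_systems.

(** * Completely positive maps *)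

Section completely_positive_maps.
Context (R : realType).
Implicit Types H K : hilbertType R.

(** The positivity of a square operator matrix, for an arbitrary finite index
    set instead of an initial segment of the integers. *)
Definition positive_kernel H (I : finType) (T : I -> I -> bop H) : Prop :=
  forall xi : I -> H, 0 <= \sum_i \sum_j hdot (T i j (xi j)) (xi i).

Lemma completely_positive_kernel H K (A : set (bop H)) (phi : bop H -> bop K)
    (I : finType) (T : I -> I -> bop H) :
  completely_positive A phi -> (forall i j, A (T i j)) -> positive_kernel T ->
  positive_kernel (fun i j => phi (T i j)).
Proof.
move=> cp AT T0 xi.
have re (V : zmodType) (F : I -> V) :
    \sum_i F i = \sum_(i < #|I|) F (enum_val i).
  by rewrite (reindex (@enum_val I I))//; exact/onW_bij/enum_val_bij.
pose M := \matrix_(i < #|I|, j < #|I|) T (enum_val i) (enum_val j).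
have AM i j : A (M i j) by rewrite mxE.
have M0 : positive_op_matrix M.
  move=> eta; have := T0 (fun i => eta (enum_rank i)).
  rewrite re; congr (0 <= _); apply: eq_bigr => i _.
  rewrite re; apply: eq_bigr => j _.
  by rewrite mxE !enum_valK.
have := cp _ M AM M0 (fun i => xi (enum_val i)).
rewrite [X in _ -> 0 <= X]re; congr (0 <= _); apply: eq_bigr => i _.
rewrite [RHS]re; apply: eq_bigr => j _.
by rewrite !mxE.
Qed.

Lemma cp_id_ge0 H K (A : set (bop H)) (phi : bop H -> bop K) w :
  A (bop_id H) -> completely_positive A phi -> 0 <= hdot (phi (bop_id H) w) w.
Proof.
move=> A1 cp.
have sum1 (V : zmodType) (F : unit -> V) : \sum_i F i = F tt.
  by apply: big_pred1 => -[].
have := @completely_positive_kernel _ _ A phi unit (fun _ _ => bop_id H) cp.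
move=> /(_ (fun _ _ => A1)) h.
have /h/(_ (fun=> w)) : positive_kernel (fun _ _ : unit => bop_id H).
  by move=> xi; rewrite !sum1 hdot_norm exprn_ge0.
by rewrite !sum1.
Qed.

Lemma ge0_conjD (z t : R[i]) : `|z| *+ 2 <= t -> 0 <= z + Num.conj z + t.
Proof.
move=> zt; have -> : z + Num.conj z = 'Re z *+ 2.
  by rewrite ReE -mulr_natr mulfVK// pnatr_eq0.
have h : - 'Re z <= `|z|.
  rewrite -raddfN -normrN; exact: (leif_Re_Creal _).
rewrite (le_trans _ (lerD (lexx _) zt))// -mulrnDl mulrn_wge0//.
by rewrite addrC -[X in _ + X]opprK subr_ge0.
Qed.

(** Let c = |a|.  The matrix with diagonal entries c 1 and off-diagonal entries
    a and a^* is positive by the Cauchy-Schwarz inequality, hence so is its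
    image under phi.  Testing that image on vectors (u, v) first shows that
    phi (a^* ) is the adjoint of phi a, and then, for u a suitable negative
    multiple of phi a v, that |phi a v| <= c |v|. *)
Lemma cp_contractive H K (A : set (bop H)) (phi : bop H -> bop K) :
  operator_system A -> linear_on A phi -> completely_positive A phi ->
  (forall u, hdot (phi (bop_id H) u) u <= `|u| ^+ 2) ->
  forall a, A a -> `|phi a| <= `|a|.
Proof.
move=> sysA lin cp phi1 a Aa.
have [A1 AL Astar] := sysA.
have [b Ab ab] := Astar a Aa.
pose c := `|a|.
have c0 : 0 <= c by exact: normr_ge0.
pose T (i j : bool) : bop H :=
  if i == j then c *: bop_id H else if i then a else b.
have AT i j : A (T i j).
  by rewrite /T; case: i j => [] [] //=; exact: operator_systemZ.
have T0 : positive_kernel T.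
  move=> xi; rewrite !big_bool /T /=; set u := xi true; set v := xi false.
  have -> : hdot (b u) v = Num.conj (hdot (a v) u) by rewrite ab -hdotC.
  have zle : `|hdot (a v) u| *+ 2 <= c * (`|u| ^+ 2 + `|v| ^+ 2).
    have h : `|hdot (a v) u| <= c * (`|u| * `|v|).
      rewrite (le_trans (hdot_CauchySchwarz _ _))// (mulrC `|u|) mulrA.
      by rewrite ler_wpM2r// opnorm_bound.
    rewrite (@le_trans _ _ (c * (`|u| * `|v|) *+ 2)) ?lerMn2r//.
    rewrite -mulrnAr ler_wpM2l// -subr_ge0.
    have -> : `|u| ^+ 2 + `|v| ^+ 2 - `|u| * `|v| *+ 2 = (`|u| - `|v|) ^+ 2.
      by rewrite sqrrB; ring.
    by rewrite real_exprn_even_ge0// rpredB// normr_real.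
  have := ge0_conjD zle; congr (0 <= _).
  rewrite !linearZl_LR /= !hdot_norm; ring.
have pos := completely_positive_kernel cp AT T0.
have phiZ : phi (c *: bop_id H) = c *: phi (bop_id H).
  exact: (linear_onZ sysA lin).
have pos1 w : 0 <= hdot (phi (bop_id H) w) w := cp_id_ge0 w A1 cp.
have {}pos u v : 0 <= c * hdot (phi (bop_id H) u) u + hdot (phi a v) u +
    (hdot (phi b u) v + c * hdot (phi (bop_id H) v) v).
  have := pos (fun i => if i then u else v).
  by rewrite !big_bool /T /= phiZ !linearZl_LR.
(* The sum of the off-diagonal terms is real for all vectors; comparing its
   values at v and i v identifies one term as the conjugate of the other. *)
have herm u v : hdot (phi b u) v = Num.conj (hdot (phi a v) u).
  have re s t : Num.conj (hdot (phi a s) t + hdot (phi b t) s) =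
      hdot (phi a s) t + hdot (phi b t) s.
    have h x y : 0 <= x -> 0 <= y -> forall z w, 0 <= x + z + (w + y) ->
        Num.conj (z + w) = z + w :> R[i].
      move=> x0 y0 z w xzwy; apply/CrealP.
      have -> : z + w = (x + z + (w + y)) - x - y by ring.
      by rewrite !rpredB// ger0_real.
    by apply: h (pos t s); rewrite mulr_ge0.
  have := re v u; have := re ('i *: v) u.
  rewrite (linearZ_LR (phi a)) linearZl_LR linearZr_LR /= conjCi.
  rewrite !rmorphD !rmorphM rmorphN /= conjCi.
  move=> h1 h2.
  set z := hdot (phi a v) u in h1 h2 *; set w := hdot (phi b u) v in h1 h2 *.
  have {h1} h1 : Num.conj w - Num.conj z = z - w.
    apply: (mulfI (neq0Ci _)).
    have -> : 'i * (z - w) = 'i * z + - 'i * w by ring.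
    by rewrite -h1; ring.
  apply: (@mulIf _ 2); first by rewrite pnatr_eq0.
  apply: (can_inj conjCK); rewrite !rmorphM /= conjCK conjC_nat.
  have -> : Num.conj w * 2 = (Num.conj w - Num.conj z) + (Num.conj z + Num.conj w).
    by ring.
  by rewrite h1 h2; ring.
rewrite [leLHS]bop_normE; apply: opnorm_le => // v.
have [->|n0] := eqVneq (phi a v) 0; first by rewrite normr0 mulr_ge0.
have np : 0 < `|phi a v| by rewrite normr_gt0.
have mp : 0 < `|v|.
  by rewrite normr_gt0; apply: contraNneq n0 => ->; rewrite raddf0.
set n := `|phi a v| in np *; set m := `|v| in mp *.
(* This multiple of phi a v has the norm m of v, so that both diagonal terms
   are at most c m^2. *)
pose r := m / n; have r0 : 0 <= r by rewrite divr_ge0 ?ltW.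
have rr : Num.conj (- r) = - r by apply/CrealP; rewrite rpredN ger0_real.
have z : hdot (phi a v) (- r *: phi a v) = - (m * n).
  rewrite linearZr_LR /= -[X in X * _]/(Num.conj (- r)) rr hdot_norm -/n.
  by rewrite mulNr /r expr2 mulrA divfK// gt_eqF.
have zr : Num.conj (- (m * n)) = - (m * n).
  by apply/CrealP; rewrite rpredN ger0_real// mulr_ge0 ?ltW.
have := pos (- r *: phi a v) v.
rewrite herm z zr.
set x := hdot _ _; set y := hdot _ _ => h.
have xm : x <= m ^+ 2.
  by rewrite /x (le_trans (phi1 _))// normrZ normrN ger0_norm// divfK// gt_eqF.
have ym : y <= m ^+ 2 by exact: phi1.
have {h} : 0 <= c * m ^+ 2 - m * n + (- (m * n) + c * m ^+ 2).
  by rewrite (le_trans h)// lerD// ?lerD2r ?lerD2l// ler_wpM2l.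
have -> : c * m ^+ 2 - m * n + (- (m * n) + c * m ^+ 2) = 2 * m * (c * m - n).
  ring.
by rewrite pmulr_rge0 ?mulr_gt0 ?ltr0n// subr_ge0.
Qed.

End completely_positive_maps.

(** * Coordinates of a Hilbert space in a finite power of another *)

Section coordinates.
Context (R : realType).
Implicit Types (G H : hilbertType R) (I : finType).

(** An isometry V of G into the power of H indexed by I, given by its components
    V_i : G -> H and their adjoints: [componentK] says V^* V = 1. *)
Record coord_isometry G H I := CoordIsometry {
  component : I -> {linear G -> H};
  cocomponent : I -> {linear H -> G};
  componentP : forall i u v, hdot (component i u) v = hdot u (cocomponent i v);
  componentK : forall u, \sum_i cocomponent i (component i u) = u }.

(** V V^* = 1, that is, V is unitary. *)
Definition coord_onto G H I (E : coord_isometry G H I) : Prop :=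
  forall i j u, component E i (cocomponent E j u) = if i == j then u else 0.

Section theory.
Context G H I (E : coord_isometry G H I).

Lemma cocomponentP i u v : hdot (cocomponent E i u) v = hdot u (component E i v).
Proof. by rewrite hdotC -componentP -hdotC. Qed.

Lemma component_norm2 u : \sum_i `|component E i u| ^+ 2 = `|u| ^+ 2.
Proof.
rewrite -hdot_norm -[in RHS](componentK E u) linear_sumr componentK.
by apply: eq_bigr => i _ /=; rewrite -componentP hdot_norm.
Qed.

Lemma component_le i u : `|component E i u| <= `|u|.
Proof.
rewrite -(@ler_pXn2r _ 2) ?nnegrE// -component_norm2 (bigD1 i)//= lerDl.
by apply: sumr_ge0 => j _; rewrite exprn_ge0.
Qed.

Lemma cocomponent_le i v : `|cocomponent E i v| <= `|v|.
Proof.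
have [->|q0] := eqVneq (cocomponent E i v) 0; first by rewrite normr0.
rewrite -(@ler_pM2r _ `|cocomponent E i v|) ?normr_gt0//.
have -> : `|cocomponent E i v| * `|cocomponent E i v| =
    `|hdot v (component E i (cocomponent E i v))|.
  by rewrite -cocomponentP hdot_norm ger0_norm ?exprn_ge0.
rewrite (le_trans (hdot_CauchySchwarz _ _))// ler_wpM2l//.
exact: component_le.
Qed.

(** The matrix V V^* of a projection is at most 1: with Q = V^* xi, the
    difference of the two sides is |xi - V Q|^2. *)
Lemma cocomponent_sum_le (xi : I -> H) :
  \sum_i \sum_j hdot (component E i (cocomponent E j (xi j))) (xi i) <=
  \sum_i `|xi i| ^+ 2.
Proof.
pose Q := \sum_j cocomponent E j (xi j).
have QE : \sum_i \sum_j hdot (component E i (cocomponent E j (xi j))) (xi i) =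
    \sum_i hdot (component E i Q) (xi i).
  by apply: eq_bigr => i _; rewrite /Q linear_sum linear_sumlz.
have Q2 : \sum_i hdot (component E i Q) (xi i) = `|Q| ^+ 2.
  rewrite -hdot_norm {2}/Q linear_sumr.
  by apply: eq_bigr => i _ /=; rewrite componentP.
rewrite QE Q2 -subr_ge0.
have -> : \sum_i `|xi i| ^+ 2 - `|Q| ^+ 2 = \sum_i `|xi i - component E i Q| ^+ 2.
  have Q2' : \sum_i hdot (xi i) (component E i Q) = `|Q| ^+ 2.
    rewrite -hdot_norm {1}/Q linear_sumlz.
    by apply: eq_bigr => i _ /=; rewrite cocomponentP.
  under [RHS]eq_bigr => i _.
    rewrite -hdot_norm linearBl linearBr linearBr /= !hdot_norm; over.
  by rewrite !sumrB Q2 Q2' component_norm2 subrr subr0.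
by apply: sumr_ge0 => i _; rewrite exprn_ge0.
Qed.

Lemma corner_subproof (T : bop G) i j :
  (fun u => component E i (T (cocomponent E j u))) \in @bounded_op R H.
Proof.
apply/asboolP; split; first by move=> c u v; rewrite !linearP.
exists `|T| => u; rewrite (le_trans (component_le _ _))//.
rewrite (le_trans (opnorm_bound _ _))// -bop_normE ler_wpM2l//.
exact: cocomponent_le.
Qed.

(** The entry V_i T V_j^* of the operator matrix V T V^*. *)
Definition corner (T : bop G) i j : bop H := Bop (corner_subproof T i j).

Lemma lift_subproof (S : bop H) i j :
  (fun u => cocomponent E i (S (component E j u))) \in @bounded_op R G.
Proof.
apply/asboolP; split; first by move=> c u v; rewrite !linearP.
exists `|S| => u; rewrite (le_trans (cocomponent_le _ _))//.
rewrite (le_trans (opnorm_bound _ _))// -bop_normE ler_wpM2l//.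
exact: component_le.
Qed.

(** V_i^* S V_j, the contribution of one matrix entry to [assemble]. *)
Definition lift_op (S : bop H) i j : bop G := Bop (lift_subproof S i j).

(** V^* S V for an operator matrix S indexed by I. *)
Definition assemble (S : I -> I -> bop H) : bop G :=
  \sum_i \sum_j lift_op (S i j) i j.

Lemma assembleE S u :
  assemble S u = \sum_i \sum_j cocomponent E i (S i j (component E j u)).
Proof.
by rewrite bop_sumE; apply: eq_bigr => i _; rewrite bop_sumE.
Qed.

Lemma corner_linear (c : R[i]) a b i j :
  corner (c *: a + b) i j = c *: corner a i j + corner b i j.
Proof. by apply: bop_ext => u; rewrite /= !linearP. Qed.

Lemma assemble_linear (c : R[i]) S T :
  assemble (fun i j => c *: S i j + T i j) = c *: assemble S + assemble T.
Proof.
rewrite /assemble scaler_sumr -big_split; apply: eq_bigr => i _ /=.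
rewrite scaler_sumr -big_split; apply: eq_bigr => j _ /=.
by apply: bop_ext => u; rewrite /= linearP.
Qed.

Lemma assemble_corner T : assemble (corner T) = T.
Proof.
apply: bop_ext => u; rewrite assembleE -[RHS](componentK E).
apply: eq_bigr => i _; rewrite -[in RHS](componentK E u) !linear_sum.
by [].
Qed.

Lemma corner_assemble S i j : coord_onto E -> corner (assemble S) i j = S i j.
Proof.
move=> onto; apply: bop_ext => u; rewrite /= assembleE linear_sum (bigD1 i)//=.
rewrite [X in _ + X]big1 ?addr0 => [|k /negPf ki]; last first.
  by rewrite linear_sum big1// => l _; rewrite onto eq_sym ki.
rewrite linear_sum (bigD1 j)//= big1 ?addr0 => [|k /negPf kj]; last first.
  by rewrite onto eqxx onto kj raddf0.
by rewrite !onto !eqxx.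
Qed.

Lemma corner_adjoint a b i j :
  adjoint_op a b -> adjoint_op (corner a i j) (corner b j i).
Proof. by move=> ab u v; rewrite /= componentP ab cocomponentP. Qed.

Lemma assemble_dot S u v :
  hdot (assemble S u) v =
  \sum_i \sum_j hdot (S i j (component E j u)) (component E i v).
Proof.
rewrite assembleE linear_sumlz; apply: eq_bigr => i _.
by rewrite linear_sumlz; apply: eq_bigr => j _ /=; rewrite cocomponentP.
Qed.

Lemma assemble_adjoint S T :
  (forall i j, adjoint_op (S i j) (T j i)) ->
  adjoint_op (assemble S) (assemble T).
Proof.
move=> ST u v; rewrite [RHS]hdotC !assemble_dot exchange_big rmorph_sum /=.
apply: eq_bigr => i _; rewrite rmorph_sum; apply: eq_bigr => j _ /=.
by rewrite ST -hdotC.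
Qed.

Lemma corner_comp a b i j :
  corner (bop_comp a b) i j = \sum_l bop_comp (corner a i l) (corner b l j).
Proof.
apply: bop_ext => u; rewrite bop_sumE /= -[in LHS](componentK E (b _)).
by rewrite !linear_sum.
Qed.

Lemma assemble_comp S T : coord_onto E ->
  bop_comp (assemble S) (assemble T) =
  assemble (fun i j => \sum_l bop_comp (S i l) (T l j)).
Proof.
move=> onto; rewrite -[LHS]assemble_corner /assemble.
apply: eq_bigr => i _; apply: eq_bigr => j _.
rewrite corner_comp; congr lift_op; apply: eq_bigr => l _.
by rewrite !corner_assemble.
Qed.

(** A crude bound, sufficient here because the index set is fixed while the
    entries are made small. *)
Lemma assemble_norm S : `|assemble S| <= \sum_i \sum_j `|S i j|.
Proof.
rewrite (le_trans (ler_norm_sum _ _ _))// ler_sum// => i _.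
rewrite (le_trans (ler_norm_sum _ _ _))// ler_sum// => j _.
rewrite [leLHS]bop_normE; apply: opnorm_le => // u.
rewrite (le_trans (cocomponent_le _ _))// (le_trans (opnorm_bound _ _))//.
rewrite -bop_normE ler_wpM2l//; exact: component_le.
Qed.

End theory.

End coordinates.

(** * Amplification of maps to operator matrices *)

Section amplification.
Context (R : realType).
Implicit Types (G H : hilbertType R) (I : finType).

(** The entrywise map on operator matrices, compressed at both ends to the
    spaces G and G' embedded in powers of H and H'. *)
Definition amplify G H G' H' I (E : coord_isometry G H I)
    (E' : coord_isometry G' H' I) (phi : bop H -> bop H') (T : bop G) : bop G' :=
  assemble E' (fun i j => phi (corner E T i j)).

Section amplify_ccp.
Context G H G' H' I (E : coord_isometry G H I) (E' : coord_isometry G' H' I).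
Context (A : set (bop H)) (A' : set (bop G)).
Hypotheses (sysA : operator_system A) (sysA' : operator_system A').
Hypothesis cornerA : forall T i j, A' T -> A (corner E T i j).

Lemma amplify_linear phi : linear_on A phi -> linear_on A' (amplify E E' phi).
Proof.
move=> lin c a b Aa Ab; rewrite /amplify -assemble_linear; congr (assemble E').
apply/funext => i; apply/funext => j.
by rewrite corner_linear lin//; exact: cornerA.
Qed.

(** An n x n matrix over B(G) becomes a matrix over B(H) indexed by pairs of an
    index below n and a coordinate; positivity is tested upstairs on the vectors
    V^* xi and downstairs on the vectors V' eta. *)
Lemma amplify_cp phi : completely_positive A phi ->
  completely_positive A' (amplify E E' phi).
Proof.
move=> cp n T AT T0.
have pairE (V : zmodType) (F : 'I_n * I -> V) :
    \sum_x F x = \sum_a \sum_i F (a, i).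
  by rewrite pair_bigA; apply: eq_bigr => -[].
pose S (x y : 'I_n * I) := corner E (T x.1 y.1) x.2 y.2.
have S0 : positive_kernel S.
  move=> xi; have := T0 (fun a => \sum_i cocomponent E i (xi (a, i))).
  congr (0 <= _); rewrite [RHS]pairE; apply: eq_bigr => a _.
  transitivity (\sum_b \sum_i \sum_j
      hdot (S (a, i) (b, j) (xi (b, j))) (xi (a, i))).
    apply: eq_bigr => b _; rewrite linear_sumr; apply: eq_bigr => i _ /=.
    rewrite linear_sum linear_sumlz; apply: eq_bigr => j _ /=.
    by rewrite componentP.
  by rewrite exchange_big; apply: eq_bigr => i _ /=; rewrite [RHS]pairE.
move=> eta.
have AS x y : A (S x y) by exact: cornerA.
have := completely_positive_kernel cp AS S0 (fun x => component E' x.2 (eta x.1)).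
congr (0 <= _); rewrite [LHS]pairE; apply: eq_bigr => a _.
under eq_bigr do rewrite pairE.
rewrite exchange_big; apply: eq_bigr => b _ /=.
by rewrite mxE assemble_dot.
Qed.

(** The entries of the matrix of 1 are those of V V^*, which is at most the
    identity matrix; by complete positivity phi preserves this inequality
    entrywise, and the image of the identity matrix is diagonal with entries
    phi 1. *)
Lemma amplify_id_le phi u : linear_on A phi -> completely_positive A phi ->
  `|phi (bop_id H)| <= 1 ->
  hdot (amplify E E' phi (bop_id G) u) u <= `|u| ^+ 2.
Proof.
move=> lin cp phi1; have [A1 _ _] := sysA; have [A'1 _ _] := sysA'.
pose d (i j : I) : bop H := (i == j)%:R *: bop_id H.
have Ad i j : A (d i j) by exact: operator_systemZ.
have Ac i j : A (corner E (bop_id G) i j) by exact: cornerA.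
pose D i j := d i j - corner E (bop_id G) i j.
have AD i j : A (D i j).
  rewrite /D -scaleN1r; apply: operator_systemD => //.
  exact: operator_systemZ.
have sumd (K : hilbertType R) (P : bop K) (xi : I -> K) i :
    \sum_j hdot (((i == j)%:R *: P) (xi j)) (xi i) = hdot (P (xi i)) (xi i).
  rewrite (bigD1 i)//= eqxx scale1r big1 ?addr0// => j.
  by rewrite eq_sym => /negPf ->; rewrite scale0r linear0l.
have D0 : positive_kernel D.
  move=> xi; have := cocomponent_sum_le E xi; rewrite -subr_ge0 -sumrB.
  congr (0 <= _); apply: eq_bigr => i _.
  rewrite -hdot_norm -[X in X - _](sumd _ (bop_id H)) -sumrB.
  by apply: eq_bigr => j _; rewrite -linearBl.
pose eta i := component E' i u.
have := completely_positive_kernel cp AD D0 eta.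
have -> : \sum_i \sum_j hdot (phi (D i j) (eta j)) (eta i) =
    \sum_i hdot (phi (bop_id H) (eta i)) (eta i) -
    hdot (amplify E E' phi (bop_id G) u) u.
  rewrite assemble_dot -sumrB; apply: eq_bigr => i _.
  rewrite -sumd -sumrB; apply: eq_bigr => j _.
  by rewrite /D (linear_onB sysA)// (linear_onZ sysA)// -linearBl.
rewrite subr_ge0 => /le_trans; apply; rewrite -(component_norm2 E' u).
apply: ler_sum => i _; rewrite -/(eta i).
rewrite -(ger0_norm (cp_id_ge0 _ A1 cp)) (le_trans (hdot_CauchySchwarz _ _))//.
rewrite expr2 ler_wpM2r// (le_trans (opnorm_bound _ _))// -bop_normE.
by rewrite ler_piMl.
Qed.

Lemma amplify_ccp (C : set (bop H')) (C' : set (bop G')) phi :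
  (forall S, (forall i j, C (S i j)) -> C' (assemble E' S)) ->
  ccp_map A C phi -> ccp_map A' C' (amplify E E' phi).
Proof.
move=> CC' [phiC lin cp contr]; have [A1 _ _] := sysA.
have phi1 : `|phi (bop_id H)| <= 1.
  exact: le_trans (contr _ A1) (bop_id_norm H).
split=> [a Aa|||].
- by apply: CC' => i j; apply: phiC; exact: cornerA.
- exact: amplify_linear.
- exact: amplify_cp.
- apply: cp_contractive => //; [exact: amplify_linear|exact: amplify_cp|].
  by move=> u; exact: amplify_id_le.
Qed.

End amplify_ccp.

End amplification.

(** * Finite powers of a Hilbert space *)

Section hilbert_power.
Context (R : realType) (K : hilbertType R) (I : finType).

(** The Hilbert direct sum of copies of K indexed by I. *)
Definition hpower := {ffun I -> K}.
HB.instance Definition _ := GRing.Lmodule.on hpower.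
Implicit Types u v w : hpower.

Definition hpower_dot u v : R[i] := \sum_i hdot (u i) (v i).

Let hpower_dot_linearl w : linear_for *%R (hpower_dot^~ w).
Proof.
move=> a u v; rewrite /hpower_dot mulr_sumr -big_split; apply: eq_bigr => i _.
by rewrite !ffunE linearPl.
Qed.

Let hpower_dotC u v : hpower_dot u v = Num.conj (hpower_dot v u).
Proof. by rewrite rmorph_sum; apply: eq_bigr => i _; exact: hdotC. Qed.

Let hpower_dot_linearr w : linear_for (Num.conj \; *%R) (hpower_dot w).
Proof.
move=> a u v; rewrite hpower_dotC hpower_dot_linearl rmorphD rmorphM /=.
by rewrite -!hpower_dotC.
Qed.

Let hpower_dot_bilinear : bilinear_for *%R (Num.conj \; *%R) hpower_dot.
Proof. by split; [exact: hpower_dot_linearl | exact: hpower_dot_linearr]. Qed.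

HB.instance Definition _ := bilinear_isBilinear.Build R[i] hpower hpower R[i]
  *%R (Num.conj \; *%R) hpower_dot hpower_dot_bilinear.

Let hpower_dot_hermitian u v :
  hpower_dot u v = (-1) ^+ false * Num.conj (hpower_dot v u).
Proof. by rewrite expr0 mul1r. Qed.

HB.instance Definition _ := isHermitianSesquilinear.Build R[i] hpower false
  (@Num.conj R[i]) hpower_dot hpower_dot_hermitian.

Let hpower_dot_gt0 u : u != 0 -> 0 < hpower_dot u u.
Proof.
move=> u0; have [i ui] : exists i, u i != 0.
  apply/not_existsP => h; move/eqP: u0; apply; apply/ffunP => i.
  by rewrite ffunE; apply/eqP/negPn/negP; exact: h.
rewrite /hpower_dot (bigD1 i)//= ltr_pwDl//.
  by rewrite hdot_norm exprn_gt0// normr_gt0.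
by apply: sumr_ge0 => j _; rewrite hdot_norm exprn_ge0.
Qed.

HB.instance Definition _ :=
  isDotProduct.Build R[i] hpower hpower_dot hpower_dot_gt0.

Definition hpower_norm u : R[i] := sqrtC (hpower_dot u u).

Let hpower_triangle u v : hpower_norm (u + v) <= hpower_norm u + hpower_norm v.
Proof. exact: (dot_sqrt_triangle hpower_dot). Qed.

Let hpower_normZ (a : R[i]) u : hpower_norm (a *: u) = `|a| * hpower_norm u.
Proof.
by rewrite /hpower_norm (@dnormZ _ _ hpower_dot) sqrtCM ?sqrCK ?nnegrE ?exprn_ge0.
Qed.

Let hpower_norm_eq0 u : hpower_norm u = 0 -> u = 0.
Proof. by move/eqP; rewrite sqrtC_eq0 (dnorm_eq0 hpower_dot) => /eqP. Qed.

HB.instance Definition _ := @Lmodule_isNormed.Build R[i] hpower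
  hpower_norm hpower_triangle hpower_normZ hpower_norm_eq0.

Lemma hpower_norm2 u : `|u| ^+ 2 = \sum_i `|u i| ^+ 2.
Proof.
by rewrite [`|u|]/(hpower_norm u) sqrtCK; apply: eq_bigr => i _; rewrite hdot_norm.
Qed.

Lemma hpower_component_le u i : `|u i| <= `|u|.
Proof.
rewrite -(@ler_pXn2r _ 2) ?nnegrE// hpower_norm2 (bigD1 i)//= lerDl.
by apply: sumr_ge0 => j _; rewrite exprn_ge0.
Qed.

(** This bound reduces convergence to convergence of the finitely many
    components. *)
Lemma hpower_norm_le u : `|u| <= \sum_i `|u i|.
Proof.
have s0 : 0 <= \sum_i `|u i| by apply: sumr_ge0.
rewrite -(@ler_pXn2r _ 2) ?nnegrE// hpower_norm2 expr2 mulr_suml.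
apply: ler_sum => i _; rewrite expr2 ler_wpM2l// (bigD1 i)//= lerDl.
exact: sumr_ge0.
Qed.

Lemma hpower_complete (F : set_system hpower) :
  ProperFilter F -> cauchy F -> cvg F.
Proof.
move=> FF Fc.
have comp i : cvg ((fun u : hpower => u i) @ F).
  apply: cauchy_cvg; apply/cauchyP => e e0.
  have /cauchyP/(_ e e0)[v Fv] := Fc; exists (v i).
  rewrite -ball_normE in Fv.
  suff : F [set u | `|v i - u i| < e] by rewrite -ball_normE.
  apply: filterS Fv => u /=; apply: le_lt_trans.
  by have := hpower_component_le (v - u) i; rewrite !ffunE.
have [l lP] := choice (fun i => (cvg_ex _).1 (comp i)).
apply/cvg_ex; exists [ffun i => l i]; apply/cvgrPdist_le => e e0.
have e1 : 0 < e / (#|I|%:R + 1) by rewrite divr_gt0// ltr_wpDl.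
have : F [set u : hpower | forall i, `|l i - u i| < e / (#|I|%:R + 1)].
  apply: filter_forall => i.
  by have /cvgrPdist_lt/(_ _ e1) := lP i.
apply: filterS => u h; rewrite (le_trans (hpower_norm_le _))//.
apply: (@le_trans _ _ (\sum_(i : I) (e / (#|I|%:R + 1)))).
  by apply: ler_sum => i _; rewrite !ffunE ltW.
rewrite sumr_const -[_ *+ _]mulr_natr -mulrA [_^-1 * _]mulrC mulrA.
by rewrite ler_pdivrMr ?ltr_wpDl// ler_wpM2l ?(ltW e0)// lerDl.
Qed.

HB.instance Definition _ := Uniform_isComplete.Build hpower hpower_complete.

HB.instance Definition _ := isHilbert.Build R hpower
  (fun u => esym (sqrtCK (hpower_dot u u))).

Definition hpower_component (i : I) (u : hpower) : K := u i.

Lemma hpower_component_linear i : linear (hpower_component i).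
Proof. by move=> c u v; rewrite /hpower_component !ffunE. Qed.

HB.instance Definition _ i := GRing.isLinear.Build R[i] hpower K *:%R
  (hpower_component i) (hpower_component_linear i).

Definition hpower_inclusion (i : I) (x : K) : hpower :=
  [ffun j => if i == j then x else 0].

Lemma hpower_inclusion_linear i : linear (hpower_inclusion i).
Proof.
move=> c x y; apply/ffunP => j; rewrite !ffunE.
by case: eqP => // _; rewrite scaler0 addr0.
Qed.

HB.instance Definition _ i := GRing.isLinear.Build R[i] K hpower *:%R
  (hpower_inclusion i) (hpower_inclusion_linear i).

Lemma hpower_adjoint i (u : hpower) (x : K) :
  hdot (hpower_component i u) x = hdot u (hpower_inclusion i x).
Proof.
rewrite [RHS]/(hpower_dot _ _) /hpower_dot (bigD1 i)//= ffunE eqxx big1 ?addr0//.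
by move=> j; rewrite eq_sym ffunE => /negPf ->; rewrite linear0r.
Qed.

Lemma hpower_resolution u : \sum_i hpower_inclusion i (hpower_component i u) = u.
Proof.
apply/ffunP => j; rewrite sum_ffunE (bigD1 j)//= ffunE eqxx big1 ?addr0//.
by move=> i /negPf ij; rewrite ffunE ij.
Qed.

Definition hpower_coord : coord_isometry hpower K I :=
  @CoordIsometry R hpower K I (fun i => hpower_component i)
    (fun i => hpower_inclusion i) hpower_adjoint hpower_resolution.

Lemma hpower_coord_onto : coord_onto hpower_coord.
Proof. by move=> i j x; rewrite /= /hpower_component ffunE eq_sym. Qed.

End hilbert_power.

(** * Bounded operators out of a space of square-summable functions *)

Section l2_operators.
Context (R : realType).
Implicit Types (X Z : choiceType) (H : hilbertType R).

Lemma normcE (z : R[i]) : (normc z)%:C = `|z|.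
Proof. by case: z. Qed.

Lemma esum_single X (a : X -> \bar R) (x : X) :
  (0 <= a x)%E -> (forall z, z != x -> a z = 0%E) ->
  \esum_(z in [set: X]) a z = a x.
Proof.
move=> ax a0; rewrite -(esum_set1 ax) [RHS]esum_mkcond.
apply: eq_esum => z _; case: ifPn => // h; apply: a0; move: h.
by apply: contraNneq => ->; rewrite inE.
Qed.

Lemma rsum_single X (f : X -> R) (x : X) :
  (forall z, z != x -> f z = 0) -> rsum f = f x.
Proof.
move=> f0; rewrite /rsum (@esum_single _ _ x) ?funepos_ge0//; last first.
  by move=> z zx; rewrite funeposE /= f0// max_l.
rewrite (@esum_single _ _ x) ?funeneg_ge0//; last first.
  by move=> z zx; rewrite funenegE /= f0// oppr0 max_l.
rewrite funeposE funenegE /=.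
have [h|h] := leP 0 (f x).
  by rewrite max_l ?lee_fin// max_r ?sube0// lee_fin oppr_le0.
by rewrite max_r ?lee_fin ?ltW// max_l ?sub0e /= ?opprK// lee_fin oppr_ge0 ltW.
Qed.

Lemma hdot_delta X (f : l2 R X) x : hdot f (l2_delta R x) = f x.
Proof.
rewrite [LHS]/(l2_dot f _) /l2_dot /csum.
rewrite !(@rsum_single _ _ x) => [|z zx|z zx]; last 2 first.
- by rewrite /= (negPf zx) conjC0 mulr0.
- by rewrite /= (negPf zx) conjC0 mulr0.
by rewrite /= eqxx conjC1 mulr1; case: (f x).
Qed.

Lemma hdot_eq0 X (f g : l2 R X) :
  (forall x, f x * Num.conj (g x) = 0) -> hdot f g = 0.
Proof.
move=> fg; rewrite [LHS]/(l2_dot f g) /l2_dot /csum.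
have r0 (p : R[i] -> R) : p 0 = 0 ->
    rsum (fun x => p (f x * Num.conj (g x))) = 0.
  move=> p0; rewrite /rsum !esum1 ?sube0// => x _.
    by rewrite funenegE /= fg p0 oppr0 max_l.
  by rewrite funeposE /= fg p0 max_l.
by rewrite (r0 (@complex.Re R))// (r0 (@complex.Im R)).
Qed.

(** Finitely supported vectors; for c an element of l2, its truncation to s. *)
Definition l2_trunc X (c : X -> R[i]) (s : seq X) : l2 R X :=
  \sum_(x <- s) c x *: l2_delta R x.

Lemma hdot_trunc X H (p : {linear l2 R X -> H}) c s (w : H) :
  hdot (p (l2_trunc c s)) w = \sum_(x <- s) c x * hdot (p (l2_delta R x)) w.
Proof.
rewrite linear_sum linear_sumlz; apply: eq_bigr => x _ /=.
by rewrite linearZ linearZl_LR.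
Qed.

Lemma l2_truncE X (c : X -> R[i]) s x : uniq s ->
  l2_trunc c s x = if x \in s then c x else 0.
Proof.
(* Here, as below, the bounded operator of [hdot_trunc] is the identity. *)
move=> us; rewrite -hdot_delta -[l2_trunc c s]/(idfun (l2_trunc c s)).
rewrite hdot_trunc.
under eq_bigr do rewrite /= hdot_delta /=.
case: ifPn => xs; last first.
  rewrite big_seq big1// => z zs; case: eqP => [xz|]; last by rewrite mulr0.
  by rewrite xz zs in xs.
rewrite (bigD1_seq x)//= eqxx mulr1 big1 ?addr0// => z zx.
by rewrite eq_sym (negPf zx) mulr0.
Qed.

Lemma l2_trunc_norm2 X (c : X -> R[i]) s : uniq s ->
  `|l2_trunc c s| ^+ 2 = \sum_(x <- s) `|c x| ^+ 2.
Proof.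
move=> us; rewrite -hdot_norm -[X in hdot X _]/(idfun (l2_trunc c s)).
rewrite hdot_trunc big_seq [RHS]big_seq; apply: eq_bigr => x xs.
by rewrite hdotC hdot_delta l2_truncE// xs normCK.
Qed.

(** The finite partial sums of the squared coefficients approach |f|^2, and the
    squared distance from f to its truncation is the missing part. *)
Lemma l2_approx X (f : l2 R X) (e : R) : 0 < e ->
  exists s, `|f - l2_trunc f s| <= e%:C.
Proof.
move=> e0; have e2 : 0 < e ^+ 2 by rewrite exprn_gt0.
have := ub_ereal_sup_adherent e2 (l2_finE f).
case=> _ [A [finA _] <-]; rewrite fsumEFin// fsbig_finite//=.
set s : seq X := finmap.enum_fset (fset_set A).
have us : uniq s by exact: finmap.fset_uniq.
pose t := fine (\esum_(x in [set: X]) (normc (f x) ^+ 2)%:E).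
have tE : \esum_(x in [set: X]) (normc (f x) ^+ 2)%:E = t%:E.
  by rewrite fineK ?l2_finE.
rewrite -[ereal_sup _]/(\esum_(x in [set: X]) (normc (f x) ^+ 2)%:E) tE.
rewrite -EFinD lte_fin => h; exists s.
rewrite -(@ler_pXn2r _ 2) ?nnegrE ?lecR ?(ltW e0)//.
rewrite -(hdot_norm (f - l2_trunc f s)) dnormB !hdot_norm (l2_trunc_norm2 f us).
have ft : hdot (l2_trunc f s) f = \sum_(x <- s) `|f x| ^+ 2.
  rewrite -[X in hdot X _]/(idfun (l2_trunc f s)) hdot_trunc.
  by apply: eq_bigr => x _; rewrite hdotC hdot_delta normCK.
rewrite hdotC ft.
have sr : \sum_(x <- s) `|f x| ^+ 2 = (\sum_(x <- s) normc (f x) ^+ 2)%:C.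
  by rewrite rmorph_sum; apply: eq_bigr => x _; rewrite rmorphXn /= normcE.
have cr (x : R) : Num.conj (x%:C) = x%:C.
  by apply/eqP; rewrite eq_complex /= oppr0 !eqxx.
rewrite sr !cr opprD addrA addrK.
rewrite (l2_norm2 f) -/t -rmorphXn -rmorphB lecR ltW// ltrBlDl -ltrBlDr.
exact: h.
Qed.

(** Both sides are bounded linear functionals of u, and the deltas have a dense
    linear span. *)
Lemma l2_dot_determined X H (p : {linear l2 R X -> H}) (M : R[i]) (w : H)
    (w' : l2 R X) :
  0 <= M ->
  (forall u, `|p u| <= M * `|u|) ->
  (forall x, hdot (p (l2_delta R x)) w = Num.conj (w' x)) ->
  forall u, hdot (p u) w = hdot u w'.
Proof.
move=> M0 pM pw u; apply/eqP; rewrite -subr_eq0 -normr_le0.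
apply/ler_addgt0Pl => e e0; rewrite addr0.
pose c := M * `|w| + `|w'| + 1.
have c0 : 0 < c by rewrite ltr_wpDl// addr_ge0// mulr_ge0.
have [|s] := @l2_approx _ u (complex.Re (e / c)).
  by rewrite -ltcR RRe_real ?divr_gt0// gtr0_real// divr_gt0.
rewrite RRe_real ?gtr0_real ?divr_gt0//; set t := l2_trunc u s => ut.
have tt' : hdot (p t) w = hdot t w'.
  rewrite -[t in RHS]/(idfun t) !hdot_trunc; apply: eq_bigr => x _.
  by rewrite pw /= [in RHS]hdotC hdot_delta.
have -> : hdot (p u) w - hdot u w' = hdot (p (u - t)) w - hdot (u - t) w'.
  by rewrite linearB !linearBl /= tt' opprB addrA subrK.
rewrite (le_trans (ler_normB _ _))//.
rewrite (@le_trans _ _ ((M * `|w| + `|w'|) * `|u - t|))//.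
  rewrite mulrDl lerD//.
    rewrite (le_trans (hdot_CauchySchwarz _ _))// mulrAC ler_wpM2r//.
  by rewrite mulrC hdot_CauchySchwarz.
rewrite (@le_trans _ _ ((M * `|w| + `|w'|) * (e / c)))//.
  by rewrite ler_wpM2l// addr_ge0// mulr_ge0.
rewrite mulrCA ler_piMr ?(ltW e0)// ler_pdivrMr// mul1r /c lerDl.
exact: ler01.
Qed.

(** The coefficient of p' w at x has to be <w, p delta_x>.  These coefficients
    are square-summable: if t is the vector with these coefficients on a finite
    set, then |t|^2 = <p t, w> <= M |t| |w|, whence |t| <= M |w|. *)
Lemma l2_adjoint X H (p : {linear l2 R X -> H}) (M : R[i]) :
  0 <= M -> (forall u, `|p u| <= M * `|u|) ->
  exists p' : {linear H -> l2 R X},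
    (forall u w, hdot (p u) w = hdot u (p' w)) /\
    (forall w, `|p' w| <= M * `|w|).
Proof.
move=> M0 pM; pose c w x := hdot w (p (l2_delta R x)).
pose m (w : H) := complex.Re (M * `|w|).
have mE w : M * `|w| = (m w)%:C by rewrite RRe_real// ger0_real// mulr_ge0.
have m0 w : 0 <= m w by rewrite -lecR -mE mulr_ge0.
have bnd w s : uniq s -> \sum_(x <- s) normc (c w x) ^+ 2 <= m w ^+ 2.
  move=> us; pose t := l2_trunc (c w) s.
  have t2 : `|t| ^+ 2 = \sum_(x <- s) `|c w x| ^+ 2 by exact: l2_trunc_norm2.
  have pt : hdot (p t) w = `|t| ^+ 2.
    rewrite hdot_trunc t2; apply: eq_bigr => x _.
    by rewrite hdotC -normCK.
  have tm : `|t| <= M * `|w|.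
    have [->|t0] := eqVneq t 0; first by rewrite normr0 mulr_ge0.
    rewrite -(@ler_pM2r _ `|t|) ?normr_gt0// -expr2.
    rewrite -[leLHS]ger0_norm ?exprn_ge0// -pt.
    by rewrite (le_trans (hdot_CauchySchwarz _ _))// mulrAC ler_wpM2r.
  rewrite -lecR rmorph_sum rmorphXn /= -mE.
  under eq_bigr do rewrite rmorphXn /= normcE.
  by rewrite -t2 ler_pXn2r ?nnegrE// mulr_ge0.
have cS w : c w \in @square_summable R X by exact: (square_summableP (bnd w)).1.
have lin : linear (fun w => L2 (cS w)).
  by move=> a u v; apply: l2_ext => x; rewrite /= /c linearPl.
pose p' : {linear H -> l2 R X} :=
  HB.pack (fun w => L2 (cS w)) (GRing.isLinear.Build _ _ _ _ _ lin).
exists p'; split=> [u w|w]; last first.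
  by rewrite mE; apply: l2_norm_le => // s us; exact: bnd.
apply: l2_dot_determined M0 pM _ u => x.
by rewrite /= /c -hdotC.
Qed.

Lemma bop_l2_adjoint X (T : bop (l2 R X)) : exists T', adjoint_op T T'.
Proof.
have [p' [adj p'T]] := l2_adjoint (opnorm_ge0 T) (opnorm_bound T).
have p'B : (fun u => p' u) \in @bounded_op R (l2 R X).
  apply/asboolP; split; first by move=> c u v; rewrite linearP.
  by exists (opnorm T)%:C.
by exists (Bop p'B).
Qed.

End l2_operators.

(** * Coordinates from labelled points *)

Section labelled_l2.
Context (R : realType) (X Z : choiceType) (I : finType).

(** Injectivity of h makes the restriction along h of a delta at a point of
    the range of h a delta. *)
Lemma label_delta (h : Z -> I * X) : injective h -> forall y z,
  (if (h y).1 == (h z).1 then l2_delta R (h z).2 (h y).2 else 0) =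
  l2_delta R z y.
Proof.
move=> hinj y z; rewrite /=.
have [->|yz] := eqVneq y z; first by rewrite !eqxx.
case: eqP => // y1; case: eqP => // y2; case/eqP: yz; apply: hinj.
by rewrite (surjective_pairing (h y)) y1 y2 -surjective_pairing.
Qed.

(** An injection of Z into I x X embeds l2(Z) into the power of l2(X).  The
    adjoints of the components restrict a function on X along h to the points
    labelled i, which is contractive because h is injective on these points;
    the components themselves are then obtained as adjoints. *)
Lemma labelled_coord (h : Z -> I * X) : injective h ->
  exists E : coord_isometry (l2 R Z) (l2 R X) I,
    forall i v z, cocomponent E i v z = if (h z).1 == i then v (h z).2 else 0.
Proof.
move=> hinj.
pose c i (v : l2 R X) z : R[i] := if (h z).1 == i then v (h z).2 else 0.
pose m (v : l2 R X) := complex.Re `|v|.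
have mE v : `|v| = (m v)%:C by rewrite RRe_real.
have bnd i v s : uniq s -> \sum_(z <- s) normc (c i v z) ^+ 2 <= m v ^+ 2.
  move=> us; rewrite (bigID (fun z => (h z).1 == i))/= [X in _ + X]big1 ?addr0.
    under eq_bigr => z zi do rewrite /c zi.
    rewrite -big_filter -(big_map (fun z => (h z).2) xpredT
      (fun x => normc (v x) ^+ 2)).
    apply: l2_sum_le; last by rewrite -mE.
    rewrite map_inj_in_uniq ?filter_uniq// => y z.
    rewrite !mem_filter => /andP[/eqP yi _] /andP[/eqP zi _] yz.
    by apply: hinj; rewrite (surjective_pairing (h y)) yi yz -zi -surjective_pairing.
  by move=> z /negPf zi; rewrite /c zi normc0 expr0n.
have cS i v : c i v \in @square_summable R Z.
  exact: (square_summableP (bnd i v)).1.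
have lin i : linear (fun v => L2 (cS i v)).
  move=> a u v; apply: l2_ext => z.
  rewrite -[RHS]/(a * c i u z + c i v z) /= /c.
  by case: ifP => // _; rewrite mulr0; exact: (esym (addr0 (0 : R[i]))).
pose q i : {linear l2 R X -> l2 R Z} :=
  HB.pack (fun v => L2 (cS i v)) (GRing.isLinear.Build _ _ _ _ _ (lin i)).
have q1 i v : `|q i v| <= 1 * `|v|.
  rewrite mul1r mE; apply: l2_norm_le => [|s us]; last exact: bnd.
  by rewrite -lecR -mE; exact: normr_ge0.
have [p pP] := choice (fun i => l2_adjoint ler01 (q1 i)).
have adj i u v : hdot (p i u) v = hdot u (q i v).
  by have [/(_ v u) pq _] := pP i; rewrite hdotC -pq -hdotC.
have res u : \sum_i q i (p i u) = u.
  apply: l2_ext => z; rewrite -hdot_delta linear_sumlz (bigD1 (h z).1)//=.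
  rewrite big1 ?addr0 => [|i /negPf zi]; last first.
    by rewrite hdot_delta /= /c eq_sym zi.
  rewrite hdot_delta /= /c eqxx -hdot_delta adj -[RHS]hdot_delta.
  by congr (hdot u _); apply: l2_ext => y; exact: label_delta.
by exists (CoordIsometry adj res).
Qed.

Context (h : Z -> I * X) (E : coord_isometry (l2 R Z) (l2 R X) I).
Hypothesis hinj : injective h.
Hypothesis cocomponentE : forall i v z,
  cocomponent E i v z = if (h z).1 == i then v (h z).2 else 0.

Lemma cocomponent_delta z :
  cocomponent E (h z).1 (l2_delta R (h z).2) = l2_delta R z.
Proof.
by apply: l2_ext => y; rewrite cocomponentE; exact: label_delta.
Qed.

Lemma cocomponent_delta0 i x :
  (forall z, h z <> (i, x)) -> cocomponent E i (l2_delta R x) = 0.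
Proof.
move=> hx; apply: l2_ext => y; rewrite cocomponentE /=.
case: eqP => // y1; case: eqP => // y2; case: (hx y).
by rewrite (surjective_pairing (h y)) y1 y2.
Qed.

Lemma component_delta i z : component E i (l2_delta R z) =
  if (h z).1 == i then l2_delta R (h z).2 else 0.
Proof.
apply: l2_ext => x; rewrite -hdot_delta componentP hdotC hdot_delta cocomponentE.
case: ifP => _; last by rewrite conjC0.
by rewrite /= eq_sym; case: eqP; rewrite ?conjC1 ?conjC0.
Qed.

Lemma component_hdot i u x :
  component E i u x = hdot u (cocomponent E i (l2_delta R x)).
Proof. by rewrite -componentP hdot_delta. Qed.

(** When h is also surjective it merely renames the standard basis. *)
Lemma labelled_onto : (forall w, exists z, h z = w) -> coord_onto E.
Proof.
move=> hsurj i j v; apply: l2_ext => x; rewrite component_hdot.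
have [z hz] := hsurj (i, x); have := cocomponent_delta z.
rewrite hz /= => ->; rewrite hdot_delta cocomponentE hz /=.
by case: eqP.
Qed.

End labelled_l2.

(** The space on which the matrices over M_k indexed by I act: its basis is
    an enumeration of the pairs of an element of I and a basis vector. *)
Lemma l2_matrix_coord (R : realType) (I : finType) k :
  exists n (M : coord_isometry (l2 R 'I_n) (l2 R 'I_k) I), coord_onto M.
Proof.
pose h : 'I_#|{: I * 'I_k}| -> I * 'I_k := enum_val.
have hinj : injective h by exact: enum_val_inj.
have [M MP] := labelled_coord R hinj; exists _, M.
apply: (labelled_onto hinj MP) => w; exists (enum_rank w).
exact: enum_rankK.
Qed.

Lemma full_operator_system (R : realType) (X : choiceType) :
  operator_system [set: bop (l2 R X)].
Proof.
split=> // a _; have [b ab] := bop_l2_adjoint a.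
by exists b.
Qed.

(** The approximants of theta on the finitely many entries of the given
    operators are amplified through the matrices over M_k.  At this middle
    stage the coordinates are unitary, so the entries of the assembled matrix
    are the original ones and the composite of the amplifications is the
    amplification of the composite. *)
Theorem amplify_nuclear (R : realType) (G H G' H' : hilbertType R) (I : finType)
    (E : coord_isometry G H I)
    (E' : coord_isometry G' H' I) (A : set (bop H)) (A' : set (bop G))
    (C : set (bop H')) (C' : set (bop G')) (theta : bop H -> bop H') :
  operator_system A -> operator_system A' ->
  (forall T i j, A' T -> A (corner E T i j)) ->
  (forall S, (forall i j, C (S i j)) -> C' (assemble E' S)) ->
  nuclear_map A C theta -> nuclear_map A' C' (amplify E E' theta).
Proof.
have sysM k := @full_operator_system R 'I_k.
move=> sysA sysA' AA' CC' nuc F e finF FA e0.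
pose F1 := (fun x : bop G * (I * I) => corner E x.1 x.2.1 x.2.2) @` (F `*` setT).
(* Adding 1 keeps the divisor positive when I is empty. *)
pose c : R := (#|I| * #|I|)%:R.
have e1 : 0 < e / (c + 1) by rewrite divr_gt0// ltr_wpDl.
have [||k [phi [psi [phiP psiP approx]]]] := nuc F1 _ _ _ e1.
- by apply: finite_image; apply: finite_setX => //; exact: finite_finset.
- by move=> _ [[a [i j]] [/= Fa _] <-]; apply: AA'; exact: FA.
have [n [M Monto]] := l2_matrix_coord R I k.
exists n, (amplify E M phi), (amplify M E' psi); split.
- by apply: amplify_ccp phiP.
- by apply: amplify_ccp psiP.
move=> a Fa.
have -> : amplify M E' psi (amplify E M phi a) - amplify E E' theta a =
    assemble E' (fun i j => psi (phi (corner E a i j)) - theta (corner E a i j)).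
  rewrite addrC -scaleN1r -assemble_linear; congr (assemble E').
  apply/funext => i; apply/funext => j.
  by rewrite corner_assemble// scaleN1r addrC.
rewrite (le_lt_trans (assemble_norm _ _))//.
apply: (@le_lt_trans _ _ (\sum_(i : I) \sum_(j : I) (e / (c + 1))%:C)).
  apply: ler_sum => i _; apply: ler_sum => j _; apply/ltW/approx.
  by exists (a, (i, j)).
rewrite !sumr_const -mulrnA -rmorphMn /= ltcR -[_ *+ _]mulr_natr -/c.
rewrite -mulrA [_^-1 * _]mulrC mulrA ltr_pdivrMr ?ltr_wpDl//.
by rewrite ltr_pM2l// ltrDl.
Qed.

(** * The uniform Roe algebra *)

Section closure.
Context (R : realType).
Implicit Types H K : hilbertType R.

Lemma closure_bopP H (A : set (bop H)) T :
  closure A T <-> forall e : R, 0 < e -> exists2 S, A S & `|T - S| < e%:C.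
Proof.
split=> [clT e e0|h B /nbhs_ballP[e /= e0 eB]].
  have [|S [AS TS]] := clT (ball T e%:C).
    by apply: nbhsx_ballx; rewrite ltcR.
  by exists S => //; move: TS; rewrite -ball_normE.
have eE : e = (complex.Re e)%:C by rewrite RRe_real// gtr0_real.
have [|S AS TS] := h (complex.Re e); first by rewrite -ltcR -eE.
exists S; split=> //; apply: eB; rewrite -ball_normE /= eE.
exact: TS.
Qed.

(** Allowing the values to be in the closure makes the lemma apply to a map of
    two variables one variable at a time. *)
Lemma closure_lipschitz H K (A : set (bop H)) (B : set (bop K))
    (F : bop H -> bop K) (M : R[i]) :
  0 <= M -> (forall S T, `|F S - F T| <= M * `|S - T|) ->
  (forall S, A S -> closure B (F S)) ->
  forall T, closure A T -> closure B (F T).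
Proof.
move=> M0 FM AB T /closure_bopP clT; apply: closed_closure.
apply/closure_bopP => e e0.
have eC : 0 < e%:C by rewrite ltcR.
have c0 : 0 < M + 1 by rewrite ltr_wpDl.
have d0 : 0 < e%:C / (M + 1) by rewrite divr_gt0.
have [|S AS TS] := clT (complex.Re (e%:C / (M + 1))).
  by rewrite -ltcR RRe_real// gtr0_real.
exists (F S); first exact: AB.
rewrite RRe_real ?gtr0_real// in TS.
rewrite (le_lt_trans (FM _ _))// (le_lt_trans (ler_wpM2l M0 (ltW TS)))//.
by rewrite mulrCA -subr_gt0 -{1}[e%:C]mulr1 -mulrBr mulr_gt0// subr_gt0
  ltr_pdivrMr// mul1r ltrDl.
Qed.

End closure.

Section uniform_roe_algebra.
Context (R : realType) (X : metricType R).
Implicit Types a b : bop (l2 R X).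

Lemma uniform_roe_finite_propagation a : finite_propagation a -> uniform_roe X a.
Proof. exact: subset_closure. Qed.

Lemma finite_propagation_linear (c : R[i]) a b :
  finite_propagation a -> finite_propagation b -> finite_propagation (c *: a + b).
Proof.
move=> [r r0 ar] [s s0 bs]; exists (r + s); first exact: addr_ge0.
move=> x y rsxy.
have axy : op_matrix a x y = 0.
  by apply: ar; rewrite (le_lt_trans _ rsxy)// lerDl.
have bxy : op_matrix b x y = 0.
  by apply: bs; rewrite (le_lt_trans _ rsxy)// lerDr.
have -> : op_matrix (c *: a + b) x y = c * op_matrix a x y + op_matrix b x y.
  by rewrite /op_matrix -!hdot_delta -linearPl.
by rewrite axy bxy mulr0 addr0.
Qed.

Lemma finite_propagation_adjoint a b :
  adjoint_op a b -> finite_propagation a -> finite_propagation b.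
Proof.
move=> ab [r r0 ar]; exists r => // x y; rewrite metric_sym => xy.
rewrite /op_matrix -hdot_delta hdotC -ab hdot_delta -/(op_matrix a y x).
by rewrite ar ?conjC0.
Qed.

(** The entry at (x, y) of the product is the inner product of b delta_y,
    supported in the ball of radius s about y, and a^* delta_x, supported in
    the ball of radius r about x. *)
Lemma finite_propagation_comp a b :
  finite_propagation a -> finite_propagation b ->
  finite_propagation (bop_comp a b).
Proof.
move=> [r r0 ar] [s s0 bs]; exists (r + s); first exact: addr_ge0.
move=> x y rsxy; have [a' aa'] := bop_l2_adjoint a.
rewrite /op_matrix -hdot_delta /= aa'; apply: hdot_eq0 => z.
have [rxz|xzr] := ltP r (mdist x z); last first.
  rewrite -/(op_matrix b z y) bs ?mul0r//.
  rewrite ltNge; apply: contraL rsxy => zys.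
  by rewrite -leNgt (le_trans (metric_triangle x z y))// lerD.
have -> : a' (l2_delta R x) z = Num.conj (op_matrix a x z).
  by rewrite -hdot_delta hdotC -aa' hdot_delta.
by rewrite ar// !conjC0 mulr0.
Qed.

Lemma uniform_roe_operator_system : operator_system (uniform_roe X).
Proof.
split=> [|c a b Aa Ab|a Aa].
- apply: uniform_roe_finite_propagation; exists 0 => // x y.
  by rewrite mdist_gt0 /op_matrix /= => /negPf ->.
- have step b' : finite_propagation b' -> uniform_roe X (c *: a + b').
    move=> Pb; apply: (@closure_lipschitz _ _ _ [set T | finite_propagation T] _
      (fun a => c *: a + b') `|c| _ _ _ a Aa) => //.
      by move=> S T; rewrite /= opprD addrACA subrr addr0 -scalerBr normrZ.
    by move=> S PS; apply: subset_closure; exact: finite_propagation_linear.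
  apply: (@closure_lipschitz _ _ _ [set T | finite_propagation T] _
      (fun b => c *: a + b) 1 _ _ _ b Ab) => //.
  by move=> S T; rewrite /= opprD addrACA subrr add0r mul1r.
have [star starP] := choice (@bop_l2_adjoint R X).
exists (star a) => //.
apply: (@closure_lipschitz _ _ _ [set T | finite_propagation T] _
   star 1 _ _ _ a Aa) => // [S T|S PS].
  rewrite mul1r; apply: adjoint_op_norm => u v.
  rewrite -[(S - T) u]/(S u - T u).
  rewrite -[(star S - star T) v]/(star S v - star T v).
  by rewrite linearBl linearBr /= !starP.
by apply: subset_closure; exact: finite_propagation_adjoint (starP S) PS.
Qed.

Lemma uniform_roe_comp a b :
  uniform_roe X a -> uniform_roe X b -> uniform_roe X (bop_comp a b).
Proof.
move=> Aa Ab.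
have step b' : finite_propagation b' -> uniform_roe X (bop_comp a b').
  move=> Pb; apply: (@closure_lipschitz _ _ _ [set T | finite_propagation T] _
    (fun a => bop_comp a b') `|b'| _ _ _ a Aa) => //.
    move=> S T; rewrite mulrC.
    by have -> : bop_comp S b' - bop_comp T b' = bop_comp (S - T) b';
      [exact: bop_ext | exact: bop_comp_norm].
  by move=> S PS; apply: subset_closure; exact: finite_propagation_comp.
apply: (@closure_lipschitz _ _ _ [set T | finite_propagation T] _
    (fun b => bop_comp a b) `|a| _ _ _ b Ab) => // S T.
have -> : bop_comp a S - bop_comp a T = bop_comp a (S - T).
  by apply: bop_ext => u; rewrite -[LHS]/(a (S u) - a (T u)) -linearB.
exact: bop_comp_norm.
Qed.

End uniform_roe_algebra.

Section coarse.
Context (R : realType) (X Y : metricType R) (I : finType) (h : Y -> I * X).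
Context (E : coord_isometry (l2 R Y) (l2 R X) I).
Hypothesis hinj : injective h.
Hypothesis cocomponentE : forall i v z,
  cocomponent E i v z = if (h z).1 == i then v (h z).2 else 0.

(** V_j^* maps a delta at x' to the delta at the point of Y with label j over x'
    or, when there is no such point, to 0; so the entries of a corner of T are
    zeros and entries of T. *)
Lemma corner_op_matrix T i j x x' : op_matrix (corner E T i j) x x' != 0 ->
  exists y y', [/\ h y = (i, x), h y' = (j, x') &
    op_matrix (corner E T i j) x x' = op_matrix T y y'].
Proof.
rewrite /op_matrix /= component_hdot => nz.
have [[y hy]|/forallNP hx] := pselect (exists y, h y = (i, x)); last first.
  by rewrite (cocomponent_delta0 cocomponentE hx) linear0r eqxx in nz.
have [[y' hy']|/forallNP hx'] := pselect (exists y', h y' = (j, x')); last first.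
  by rewrite (cocomponent_delta0 cocomponentE hx') raddf0 linear0l eqxx in nz.
exists y, y'; split=> //.
have := cocomponent_delta hinj cocomponentE y; rewrite hy /= => ->.
have := cocomponent_delta hinj cocomponentE y'; rewrite hy' /= => ->.
by rewrite hdot_delta.
Qed.

Lemma lift_op_matrix S i j y y' : op_matrix (lift_op E S i j) y y' != 0 ->
  op_matrix (lift_op E S i j) y y' = op_matrix S (h y).2 (h y').2.
Proof.
rewrite /op_matrix /= cocomponentE (component_delta cocomponentE).
case: ifP => _; last by rewrite eqxx.
by case: ifP => // _; rewrite raddf0 eqxx.
Qed.

Lemma corner_uniform_roe T i j :
  (forall r : R, exists s : R, forall y y', mdist y y' <= r ->
     mdist (h y).2 (h y').2 <= s) ->
  uniform_roe Y T -> uniform_roe X (corner E T i j).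
Proof.
move=> ctrl; apply: (@closure_lipschitz _ _ _ _ _
  (fun T => corner E T i j) 1) => // [S {}T|S [r r0 Sr]].
  have -> : corner E S i j - corner E T i j = corner E (S - T) i j.
    apply: bop_ext => u; rewrite -[LHS]/(component E i _ - component E i _).
    by rewrite -linearB.
  rewrite bop_normE; apply: opnorm_le => [|u]; first by rewrite mulr_ge0.
  rewrite (le_trans (component_le _ _ _))// (le_trans (opnorm_bound _ _))//.
  by rewrite mul1r -bop_normE ler_wpM2l// cocomponent_le.
have [s sP] := ctrl r.
apply: uniform_roe_finite_propagation; exists `|s| => // x x' sxx.
apply: contraTeq sxx => nz; have [y [y' [hy hy' eq]]] := corner_op_matrix nz.
rewrite -leNgt (le_trans _ (ler_norm s))//.
have := sP y y'; rewrite hy hy' /=; apply; rewrite leNgt.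
by apply/negP => /Sr S0; rewrite eq S0 eqxx in nz.
Qed.

Lemma assemble_uniform_roe S :
  (forall r : R, exists s : R, forall y y', mdist (h y).2 (h y').2 <= r ->
     mdist y y' <= s) ->
  (forall i j, uniform_roe X (S i j)) -> uniform_roe Y (assemble E S).
Proof.
move=> ctrl XS; have sys := uniform_roe_operator_system Y.
apply: (operator_system_sum sys) => i; apply: (operator_system_sum sys) => j.
move: (S i j) (XS i j).
apply: (@closure_lipschitz _ _ _ _ _
  (fun T => lift_op E T i j) 1) => // [T T'|T [r r0 Tr]].
  have -> : lift_op E T i j - lift_op E T' i j = lift_op E (T - T') i j.
    apply: bop_ext => u; rewrite -[LHS]/(cocomponent E i _ - cocomponent E i _).
    by rewrite -linearB.
  rewrite bop_normE; apply: opnorm_le => [|u]; first by rewrite mulr_ge0.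
  rewrite (le_trans (cocomponent_le _ _ _))// (le_trans (opnorm_bound _ _))//.
  by rewrite mul1r -bop_normE ler_wpM2l// component_le.
have [s sP] := ctrl r.
apply: uniform_roe_finite_propagation; exists `|s| => // y y' syy.
apply: contraTeq syy => nz.
rewrite -leNgt (le_trans _ (ler_norm s))// sP// leNgt.
apply/negP => /Tr T0; move/eqP: (nz); apply.
by rewrite (lift_op_matrix nz).
Qed.

End coarse.

(** * Coarse equivalences *)

Section coarse_equivalence.
Context (R : realType).
Implicit Types X Y : metricType R.

(** Two points of Y with the same image in X are at distance at most 2 M, where
    M bounds the displacement of the composite of the two coarse maps; hence a
    ball of radius 2 M + 1 contains each fiber and a bound for the cardinality
    of such balls is a sufficient number of labels. *)
Lemma coarse_labelling X Y : bounded_geometry Y -> coarsely_equivalent X Y ->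
  exists (n : nat) (h : Y -> 'I_n * X),
  [/\ injective h,
      forall r : R, exists s : R, forall y y', mdist y y' <= r ->
        mdist (h y).2 (h y').2 <= s
    & forall r : R, exists s : R, forall y y', mdist (h y).2 (h y').2 <= r ->
        mdist y y' <= s].
Proof.
move=> bgY [g [f [[g_ctrl _] [f_ctrl _] _ [M gfM]]]].
have gf y y' : mdist y y' <= mdist (g (f y)) (g (f y')) + (M + M).
  rewrite (le_trans (metric_triangle y (g (f y)) y'))//.
  rewrite addrCA metric_sym lerD ?gfM//.
  by rewrite (le_trans (metric_triangle _ (g (f y')) _))// lerD2l gfM.
pose r := `|M + M| + 1.
have r0 : 0 < r by rewrite ltr_wpDl.
have [N cardN] := bgY r r0.
have fiber y y' : f y = f y' -> ball y r y'.
  move=> fyy'; rewrite ballEmdist /=.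
  rewrite (le_lt_trans (gf y y'))// fyy' mdistxx add0r.
  by rewrite (le_lt_trans (ler_norm _))// ltrDl.
have lab x : exists l : Y -> nat, forall y y', f y = x -> f y' = x ->
    (l y < N)%N /\ (l y = l y' -> y = y').
  have [[y0 fy0]|/forallNP nf] := pselect (exists y0, f y0 = x); last first.
    by exists (fun=> 0%N) => y y' /nf.
  have /pcard_leP/unsquash l := cardN y0; exists l => y y' fy fy'.
  have By : ball y0 r y by apply: fiber; rewrite fy0.
  have By' : ball y0 r y' by apply: fiber; rewrite fy0.
  split; first exact: (@funS _ _ _ _ l _ By).
  by apply: (@inj _ _ _ l); rewrite inE.
have [l lP] := choice lab.
have lN y : (l (f y) y < N)%N by have [] := lP (f y) y y erefl erefl.
exists N, (fun y => (Ordinal (lN y), f y)); split=> [y y' [ll ff]|s|s] /=.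
- have [_] := lP (f y) y y' erefl (esym ff); apply.
  by rewrite ll ff.
- exact: f_ctrl.
have [t tP] := g_ctrl s; exists (t + (M + M)) => y y' /tP gg.
by rewrite (le_trans (gf y y'))// lerD2r.
Qed.

Theorem coarse_transfer X Y : bounded_geometry Y -> coarsely_equivalent X Y ->
  (nuclear_algebra (uniform_roe X) -> nuclear_algebra (uniform_roe Y)) /\
  (exact_algebra (uniform_roe X) -> exact_algebra (uniform_roe Y)).
Proof.
move=> bgY XY; have [n [h [hinj ctrl expand]]] := coarse_labelling bgY XY.
have [E cocE] := labelled_coord R hinj.
have sysX := uniform_roe_operator_system X.
have sysY := uniform_roe_operator_system Y.
have cornerX T i j : uniform_roe Y T -> uniform_roe X (corner E T i j).
  exact: (corner_uniform_roe hinj cocE ctrl).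
have assembleY S : (forall i j, uniform_roe X (S i j)) ->
    uniform_roe Y (assemble E S).
  exact: (assemble_uniform_roe cocE expand).
split=> [nucX|[K [rho [[rhoL rhoM rhoA] rhoI nucX]]]].
  (* Taking the entries of an operator and assembling them gives it back. *)
  have -> : nuclear_algebra (uniform_roe Y) =
      nuclear_map (uniform_roe Y) (uniform_roe Y) (amplify E E id).
    congr nuclear_map; apply/funext => T.
    by rewrite [RHS](assemble_corner E).
  exact: amplify_nuclear nucX.
pose E' := hpower_coord K 'I_n.
have E'onto : coord_onto E' by exact: hpower_coord_onto.
exists (hpower K 'I_n), (amplify E E' rho); split.
- split=> [|a b Ya Yb|a b Ya Yb ab].
  + exact: (amplify_linear E' cornerX).
  + rewrite /amplify assemble_comp//; congr assemble.
    apply/funext => i; apply/funext => j.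
    rewrite corner_comp (linear_on_sum sysX)//; last first.
      by move=> l; apply: uniform_roe_comp; exact: cornerX.
    by apply: eq_bigr => l _; apply: rhoM; exact: cornerX.
  + apply: assemble_adjoint => i j; apply: rhoA; [exact: cornerX..|].
    exact: corner_adjoint.
- move=> a b Ya Yb ab; rewrite -(assemble_corner E a) -(assemble_corner E b).
  congr assemble; apply/funext => i; apply/funext => j.
  apply: rhoI; [exact: cornerX..|].
  by have := congr1 (fun T => corner E' T i j) ab; rewrite !corner_assemble.
- exact: amplify_nuclear nucX.
Qed.

Lemma coarsely_equivalent_sym X Y :
  coarsely_equivalent X Y -> coarsely_equivalent Y X.
Proof. by move=> [f [g [cf cg gf fg]]]; exists g, f; split. Qed.

End coarse_equivalence.

Theorem corollary5 (R : realType) (X Y : metricType R)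
    (hX : uniformly_discrete X) (hXg : bounded_geometry X)
    (hY : uniformly_discrete Y) (hYg : bounded_geometry Y)
    (hXY : coarsely_equivalent X Y) :
  (nuclear_algebra (uniform_roe X) <-> nuclear_algebra (uniform_roe Y)) /\
  (exact_algebra (uniform_roe X) <-> exact_algebra (uniform_roe Y)).
Proof.
have [nXY eXY] := coarse_transfer hYg hXY.
have [nYX eYX] := coarse_transfer hXg (coarsely_equivalent_sym hXY).
by [].
Qed.
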